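(* Let $p\ge2$, let $T=(T^{(N)})_{N\ge1}$ be a sequence of heavy-Wigner tensors of order $p$ with parameters $(M_k)_{k\ge2}$, and let $\nu$ be the limit (weakly in probability, as $N\to\infty$) of the empirical spectral distributions of the matrices $$(\tilde A_N)_{a,b}=\frac{1}{\sqrt{M_2(p-2)!}}\sum_{j_1,\dots,j_{p-2}=1}^N T^{(N)}_{a,b,j_1,\dots,j_{p-2}},\qquad 1\le a,b\le N,$$ i.e. the probability measure with moments $(\eta_k^{(M'_r)})_{k\ge0}$, $M'_r=(p-2)!^{r/2}M_r/M_2^{r/2}$. If $M_2=1$ and $M_{2r}=0$ for all $r>1$, then $\nu$ is the semicircular law supported on $[-2,2]$.
   Context: Heavy-Wigner tensors: a sequence of heavy-Wigner tensors of order $p$ with parameters $(M_k)_{k\ge2}$ is a sequence $(T^{(N)})_{N\ge1}$ of real random tensors $T^{(N)}=(T_{i_1,\dots,i_p})_{1\le i_1,\dots,i_p\le N}$ that are symmetric (invariant under permutation of the indices), whose entries indexed by $i_1\le\cdots\le i_p$ are independent (not necessarily identically distributed), such that $\mathbb{E}[T_{i_1,\dots,i_p}]=0$ for all indices, for every $k\ge2$ one has $\sup_{i_1,\dots,i_p}N^{p-1}\mathbb{E}[T_{i_1,\dots,i_p}^k]=O(1)$ as $N\to\infty$, and for all $i_1<\cdots<i_p$ and every $k\ge2$, $N^{p-1}\mathbb{E}[T_{i_1,\dots,i_p}^k]\to M_k$ as $N\to\infty$. Definition of $\eta_k$: a hypertree is a simple hypergraph (distinct hyperedges, each a set of distinct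 vertices) whose vertex–hyperedge incidence bipartite graph is a tree. A rooted $p$-uniform fat hypertree $(H,o)$ is a $p$-uniform hypertree with a distinguished vertex $o$ together with a multiplicity for each hyperedge. For a sequence of real numbers $(a_r)_{r\ge2}$, put $\eta_0^{(a_r)}=1$ and, for $k\ge1$, $$\eta_k^{(a_r)}=\sum_{(H,o)\in\mathcal{T}_k^\bullet}\frac{1}{|\mathrm{Aut}(H,o)|}\sum_{P\in P_k(H)}\ \prod_{e\in E(H)}a_{m(P,e)},$$ where $\mathcal{T}_k^\bullet$ is the set of isomorphism classes of rooted $p$-uniform fat hypertrees with $k$ hyperedges counted with multiplicity, every hyperedge having multiplicity at least $2$; $\mathrm{Aut}(H,o)$ is the group of automorphisms of $H$ (permutations of the vertices preserving hyperedges and their multiplicities) fixing the root; $P_k(H)$ is the set of closed walks of length $k$ starting from the root $o$ on the clique expansion of $H$ (the graph where two distinct vertices are adjacent iff they lie in a common hyperedge) such that, for each distinct hyperedge $e$, the number $m(P,e)$ of steps of the walk $P$ using an edge coming from $e$ equals the multiplicity of $e$ in $H$; and the product runs over the distinct hyperedges of $H$. The empirical spectral distribution of a real symmetric $N\times N$ matrix is the uniform probability measure on its eigenvalues. *)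

(* Defs.v *)
From HB Require Import structures.
From mathcomp Require Import all_boot all_order all_algebra perm.
From mathcomp Require Import boolp.

Set Implicit Arguments.
Unset Strict Implicit.
Unset Printing Implicit Defensive.

Import Order.TTheory GRing.Theory Num.Theory.

Local Open Scope ring_scope.

(* With [c] a duplicate-free cycle, [size c <= 2] only leaves the back-and-forth
   along a single edge; an irreflexive symmetric [e] has no other degenerate
   cycle. *)
Definition is_tree (T : finType) (e : rel T) : Prop :=
  [/\ (0 < #|T|)%N, forall x y, connect e x y
    & forall c : seq T, ucycle e c -> (size c <= 2)%N].

(* A rooted fat hypergraph on [V] is a multiplicity function on the subsets of
   [V], the hyperedges being the subsets of nonzero multiplicity, together with
   a root.  Multiplicities are at most [k], which is no restriction when the
   hyperedges counted with multiplicity are [k] in number. *)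
Definition rooted_fat (V : finType) (k : nat) : finType :=
  ({ffun {set V} -> 'I_k.+1} * V)%type.

Section Fat.
Variables (V : finType) (k : nat).

Implicit Type H : rooted_fat V k.

Definition mult H (e : {set V}) : nat := H.1 e.
Definition fat_root H : V := H.2.
Definition hyperedges H : {set {set V}} := [set e | mult H e != 0%N].

Definition incidence H : rel (V + {e : {set V} | e \in hyperedges H}) :=
  fun x y => match x, y with
             | inl v, inr e | inr e, inl v => v \in val e
             | _, _ => false
             end.

(* All labelled rooted p-uniform fat hypertrees on the vertex set [V], not yet
   taken up to isomorphism. *)
Definition fat_hypertrees (p : nat) : {set rooted_fat V k} :=
  [set H | [&& `[< is_tree (@incidence H) >],
               [forall e in hyperedges H, #|e| == p],
               [forall e in hyperedges H, (2 <= mult H e)%N]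
             & (\sum_(e in hyperedges H) mult H e == k)%N]].

Definition is_iso (s : {perm V}) H1 H2 : bool :=
  (s (fat_root H1) == fat_root H2) &&
  [forall e : {set V}, mult H2 (s @: e) == mult H1 e].

Definition isomorphic : rel (rooted_fat V k) :=
  fun H1 H2 => [exists s : {perm V}, is_iso s H1 H2].

Definition fat_aut H : {set {perm V}} := [set s | is_iso s H H].

Definition clique_adj H : rel V :=
  fun u v => (u != v) && [exists e in hyperedges H, (u \in e) && (v \in e)].

(* A walk starting at the root is given by its remaining [k] vertices. *)
Definition steps H (w : seq V) : seq (V * V) := zip (fat_root H :: w) w.

(* Distinct hyperedges of a hypertree share at most one vertex, hence a step
   u -> v uses an edge coming from e iff u and v both belong to e. *)
Definition walk_mult H (w : seq V) (e : {set V}) : nat :=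
  count (fun uv => (uv.1 \in e) && (uv.2 \in e)) (steps H w).

Definition closed_walks H : {set k.-tuple V} :=
  [set w : k.-tuple V | [&& path (clique_adj H) (fat_root H) w,
    last (fat_root H) w == fat_root H
    & [forall e in hyperedges H, walk_mult H w e == mult H e]]].

Definition fat_weight (R : realFieldType) (a : nat -> R) H : R :=
  #|fat_aut H|%:R^-1 *
  \sum_(w in closed_walks H) \prod_(e in hyperedges H) a (walk_mult H w e).

End Fat.

(* One labelled representative per isomorphism class on 'I_n. *)
Definition fat_hypertree_classes (p k n : nat) : {set rooted_fat 'I_n k} :=
  let D := fat_hypertrees 'I_n k p in
  transversal (equivalence_partition (@isomorphic 'I_n k) D) D.

(* A [p]-uniform hypertree with [l] hyperedges has [l * p.-1 + 1] vertices, and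
   [l <= k], so that the range of [n] covers every isomorphism class. *)
Definition eta (R : realFieldType) (p : nat) (a : nat -> R) (k : nat) : R :=
  if k is 0 then 1 else
  \sum_(n < (k * p.-1).+2) \sum_(H in fat_hypertree_classes p k n)
     fat_weight a H.

From mathcomp Require Import all_classical all_reals all_analysis.
Import numFieldNormedType.Exports.

Local Open Scope classical_set_scope.

Section Tensors.
Context d (Om : measurableType d) (R : realType) (P : probability Om R).

(* Random tensors of order [p] and of size N = n.+1, for all N >= 1. *)
Definition tensor_sequence (p : nat) : Type :=
  forall n : nat, {ffun 'I_p -> 'I_n.+1} -> {RV P >-> R}.

Definition independent_family (I : finType) (D : {set I})
    (X : I -> {RV P >-> R}) : Prop :=
  forall (J : {set I}) (B : I -> set (measurableTypeR R)),
    J \subset D -> (forall i, measurable (B i)) ->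
    P (\bigcap_(i in [set` J]) (X i @^-1` B i)) =
    (\prod_(i in J) P (X i @^-1` B i))%E.

(* The normalised moment N^(p-1) E[T_i^k], with N = n.+1. *)
Definition scaled_moment (p : nat) (T : tensor_sequence p) (k n : nat)
    (i : {ffun 'I_p -> 'I_n.+1}) : \bar R :=
  (((n.+1 ^ p.-1)%:R)%:E * 'E_P[(fun w => T n i w ^+ k)%R])%E.

Record heavy_wigner (p : nat) (M : nat -> R) (T : tensor_sequence p) : Prop :=
  HeavyWigner {
    hw_sym : forall n (i : {ffun 'I_p -> 'I_n.+1}) (s : {perm 'I_p}) w,
      T n [ffun r => i (s r)] w = T n i w;
    hw_indep : forall n, independent_family
      [set i : {ffun 'I_p -> 'I_n.+1} |
        [forall r : 'I_p, forall s : 'I_p, (r <= s)%N ==> (i r <= i s)%N]]%SET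
      (T n);
    hw_centered : forall n i, ('E_P[T n i] = 0)%E;
    hw_bounded : forall k, (2 <= k)%N ->
      exists C : R, \forall n \near \oo,
        (`|ereal_sup (range (@scaled_moment p T k n))| <= C%:E)%E;
    (* For every fixed increasing sequence of indices; [inord (i r)] is [i r] as
       soon as N is larger than all the [i r]. *)
    hw_cvg : forall (i : 'I_p -> nat) k,
      (forall r s : 'I_p, (r < s)%N -> (i r < i s)%N) -> (2 <= k)%N ->
      @scaled_moment p T k n [ffun r => inord (i r)] @[n --> \oo] --> (M k)%:E
  }.

(* The index tuple is (a, b, j_1, ..., j_{p-2}). *)
Definition contracted_matrix (p : nat) (M : nat -> R) (T : tensor_sequence p)
    (n : nat) (w : Om) : 'M[R]_n.+1 :=
  \matrix_(a, b) ((Num.sqrt (M 2%N * (p - 2)`!%:R))^-1 *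
    \sum_(j : (p - 2).-tuple 'I_n.+1)
       T n [ffun r : 'I_p => nth a [:: a, b & j] r] w).

End Tensors.

(* The eigenvalues with multiplicity, in an unspecified order; the set below is
   nonempty when [A] is symmetric. *)
Definition eigenvalues (R : realType) (n : nat) (A : 'M[R]_n) : seq R :=
  xget [::] [set s : seq R | char_poly A = \prod_(x <- s) ('X - x%:P)].

Definition esd (R : realType) (n : nat) (A : 'M[R]_n.+1) :
    {measure set (measurableTypeR R) -> \bar R} :=
  mscale (n.+1%:R^-1)%:nng
    (msum (fun i => @dirac _ (measurableTypeR R) (nth 0 (eigenvalues A) i) R)
       n.+1).

Definition cvg_weakly_in_probability d (Om : measurableType d) (R : realType)
    (P : probability Om R)
    (mu : nat -> Om -> {measure set (measurableTypeR R) -> \bar R})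
    (nu : probability (measurableTypeR R) R) : Prop :=
  forall f : R -> R, continuous f -> (exists C : R, forall x : R, `|f x| <= C) ->
  forall eps : R, 0 < eps ->
    P [set w | eps <=
      `|(\int[mu n w]_x f x)%R - (\int[nu]_x f x)%R| ] @[n --> \oo] --> 0%E.

(* M'_r = (p-2)!^(r/2) M_r / M_2^(r/2). *)
Definition normalised_parameters (R : realType) (p : nat) (M : nat -> R)
    (r : nat) : R :=
  ((p - 2)`!%:R `^ (r%:R / 2)) * M r / (M 2%N `^ (r%:R / 2)).

Definition semicircle_density (R : realType) (x : R) : R :=
  if `|x| <= 2 then Num.sqrt (4 - x ^+ 2) / (2 * pi) else 0.

Definition semicircle_law (R : realType) (A : set (measurableTypeR R)) :
    \bar R :=
  (\int[lebesgue_measure]_(x in A) (semicircle_density x)%:E)%E.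

(* Main.v *)
From HB Require Import structures.
From mathcomp Require Import all_boot all_order all_algebra perm.
From mathcomp Require Import boolp zify ring.
Require Import Defs.

Set Implicit Arguments.
Unset Strict Implicit.
Unset Printing Implicit Defensive.

Import Order.TTheory GRing.Theory Num.Theory.

(* Since [M_{4r} = 0], Cauchy-Schwarz kills the odd parameters as well, so that
   only the hyperedges of multiplicity 2 contribute to [eta].  By the
   orbit-stabilizer formula, [eta_k] is then [(p-2)!^(k/2) / n!] times the number
   of labelled pairs (hypertree on [n] vertices, closed walk crossing each
   hyperedge exactly twice).  Such a walk is a run of a stack machine: a step
   either discovers a hyperedge, all of whose vertices but the current one are
   new, or backtracks through the hyperedge on top of the stack.  Counting runs
   step by step gives [n! / (p-2)!^(k/2)] times a ballot number, so [eta_k] is a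
   Catalan number or 0.  These are the moments of the semicircle law, by the
   fundamental theorem of calculus applied to [x^(k+1) (4 - x^2)^(3/2)].  They
   are bounded by [4^k], so [nu] lives on [-2, 2], where the polynomials
   [(1 - y^n)^(n 2^n)] converge boundedly to the indicator of a half-line;
   dominated convergence identifies [nu] on half-lines. *)

(** * Hypertrees *)

(** A hyperedge of size p > 2 spans several clique edges, so two crossings of it could a priori use
    different ones. Removing the hyperedge separates its vertices, which forces the second crossing
    to undo the first. Thus every hyperedge has one entry and one exit vertex, and its other p-2
    vertices lie on no other hyperedge, since a hyperedge hanging from one of them would never be
    crossed. These vertices are interchangeable: hence a factor 1/(p-2)! per hyperedge, which M'_2 =
    (p-2)! cancels. Passing to labelled vertices replaces automorphism groups by a plain count of
    choices. *)

Lemma connect_ind (T : finType) (e : rel T) (P : T -> Prop) x y :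
  (forall u v, P u -> e u v -> P v) -> connect e x y -> P x -> P y.
Proof.
move=> eP /connectP[s]; elim: s x => [|z s IHs] x /=; first by move=> _ ->.
by case/andP=> exz es yl Px; exact: IHs es yl (eP _ _ Px exz).
Qed.

(** Incidence graphs of isomorphic hypergraphs live on different sigma types, so invariance of
    [is_tree] goes through an explicit bijection. *)
Lemma is_tree_transport (T T' : finType) (e : rel T) (e' : rel T')
    (f : T -> T') (g : T' -> T) :
    cancel f g -> cancel g f -> (forall x y, e' (f x) (f y) = e x y) ->
  is_tree e -> is_tree e'.
Proof.
move=> fK gK fe [T0 Te Tc]; have eg x y : e' x y = e (g x) (g y).
  by rewrite -fe !gK.
split.
- by case/card_gt0P: T0 => x _; apply/card_gt0P; exists (f x).
- move=> x y; rewrite -(gK y); apply: (@connect_ind _ e (fun z => connect e' x (f z)) (g x)).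
  + by move=> u v xu euv; apply: connect_trans xu (connect1 _); rewrite fe.
  + exact: Te.
  + by rewrite gK.
- move=> c /andP[ec uc]; rewrite -(size_map g); apply: Tc.
  rewrite /ucycle map_inj_uniq ?uc ?andbT; last exact: can_inj gK.
  case: c ec {uc} => //= x c; rewrite -map_rcons path_map.
  by apply: sub_path => u v; rewrite /= -eg.
Qed.

Section Hypertree.
Variable V : finType.
Implicit Types (e : {set V}) (E : {set {set V}}) (o u v x y : V).

Definition edge_adj E : rel V :=
  fun u v => [exists e in E, (u \in e) && (v \in e)].

Lemma edge_adjP E u v :
  reflect (exists e, [/\ e \in E, u \in e & v \in e]) (edge_adj E u v).
Proof.
apply: (iffP existsP) => -[e].
  by case/and3P=> *; exists e.
by case=> *; exists e; apply/and3P.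
Qed.

Lemma edge_adj_sym E : symmetric (edge_adj E).
Proof. by move=> u v; apply/edge_adjP/edge_adjP=> -[e []]; exists e. Qed.

Lemma edge_connect_sym E : connect_sym (edge_adj E).
Proof. exact/sym_connect_sym/edge_adj_sym. Qed.

Lemma edge_connectS E E' u v :
  E \subset E' -> connect (edge_adj E) u v -> connect (edge_adj E') u v.
Proof.
move=> sEE'; apply: connect_sub => {u v} u v /edge_adjP[e [eE ue ve]].
by apply: connect1; apply/edge_adjP; exists e; rewrite (subsetP sEE').
Qed.

Section Tree.
Variables (k : nat) (H : rooted_fat V k).
Local Notation E := (hyperedges H).
Local Notation inc := (@incidence V k H).

Lemma incidence_sym : symmetric inc.
Proof. by case=> [x|x] [y|y]. Qed.

(* In a hypertree, removing a hyperedge separates its vertices. *)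
Lemma tree_cut e u v : is_tree inc -> e \in E -> u \in e -> v \in e ->
  connect (edge_adj (E :\ e)) u v -> u = v.
Proof.
case=> _ _ Tc eE ue ve uv; pose ee := exist (fun e => e \in E) e eE.
(* [r] is the incidence graph without the node of [e]; paths through the remaining hyperedges lift
   to it. *)
pose r := [rel x y | [&& inc x y, x != inr ee & y != inr ee]].
have : connect r (inl u) (inl v).
  apply: (connect_ind (P := fun z => connect r (inl u) (inl z)) _ uv) => //.
  move=> x y ux /edge_adjP[e' [/setD1P[ne e'E] xe ye]].
  have ne' : inr (exist (fun e => e \in E) e' e'E) != inr ee :> V + _.
    by apply/eqP=> -[e'e]; rewrite e'e eqxx in ne.
  apply: (connect_trans ux); apply: (@connect_trans _ _ (inr (exist _ e' e'E))).
    by apply: connect1; rewrite /r /= xe ne'.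
  by apply: connect1; rewrite /r /= ye ne'.
case/connectP=> s rs.
case/shortenP: rs => s' rs' us' _ lv.
have ps' : path inc (inl u) s' by apply: sub_path rs' => x y /and3P[].
have ns' : inr ee \notin s'.
  apply/negP=> /(nthP (inr ee)) [i lti si].
  by have /(pathP (inr ee)) /(_ i lti) /and3P[_ _] := rs'; rewrite si eqxx.
(* A duplicate-free path from [u] to [v] avoiding [e] closes up through [e] into a cycle; the bound
   2 on its size leaves [s'] empty. *)
have := Tc [:: inr ee, inl u & s'].
rewrite /ucycle /= rcons_path ps' -lv /= ue ve inE negb_or ns' /=.
move: us' => /= -> /(_ isT); rewrite !ltnS leqn0 => /nilP s0.
by move: lv; rewrite s0 => -[].
Qed.

(** A second hyperedge through [u] and [v] would still connect them after the removal of [e]. This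
    is what lets [walk_mult] recognise the hyperedge of a step by its endpoints. *)
Lemma tree_linear e e' u v : is_tree inc -> e \in E -> e' \in E ->
  u != v -> u \in e -> v \in e -> u \in e' -> v \in e' -> e = e'.
Proof.
move=> Ht eE e'E nuv ue ve ue' ve'; apply/eqP; apply: contraNT nuv => nee; apply/eqP.
apply: (tree_cut Ht eE) => //; apply: connect1.
by apply/edge_adjP; exists e'; split=> //; rewrite in_setD1 eq_sym nee.
Qed.

Lemma tree_cover u v : is_tree inc -> u != v -> exists2 e, e \in E & v \in e.
Proof.
case=> _ /(_ (inl v) (inl u)) /connectP[[|[x|[e eE]] s]] /=.
- by move=> _ [->] _; rewrite eqxx.
- by [].
- by case/andP=> ve _ _ _ _; exists e.
Qed.

End Tree.

(* [stacked o E S]: the hyperedges of [E] can be glued one after the other,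
   starting from the vertex [o], each one meeting the union of the previous ones
   in a single vertex; [S] is the resulting set of vertices. *)
Inductive stacked o : {set {set V}} -> {set V} -> Prop :=
| Stacked0 : stacked o set0 [set o]
| StackedS E S e x : stacked o E S -> e :&: S = [set x] ->
    stacked o (e |: E) (e :|: S).

Lemma stacked_sub o E S e : stacked o E S -> e \in E -> e \subset S.
Proof.
elim=> [|E' S' e' x _ IH _]; rewrite !inE // => /orP[/eqP->|/IH s].
  exact: subsetUl.
exact: subset_trans s (subsetUr _ _).
Qed.

Lemma stacked_neq0 o E S e : stacked o E S -> e \in E -> exists x, x \in e.
Proof.
elim=> [|E' S' e' x _ IH eS]; rewrite !inE // => /orP[/eqP->|/IH //].
by exists x; have /setIP[] : x \in e' :&: S' by rewrite eS set11.
Qed.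

Section StackedTree.
Variables (k : nat) (H : rooted_fat V k) (o : V).
Local Notation inc := (@incidence V k H).

Lemma stacked_connect E S x : stacked o E S -> E \subset hyperedges H ->
  x \in S -> connect inc (inl o) (inl x).
Proof.
move=> st; elim: st x => [|E' S' e y st IH eS] x sEH.
  by rewrite inE => /eqP->.
have [sE eH] : E' \subset hyperedges H /\ e \in hyperedges H.
  by move: sEH; rewrite subUset sub1set => /andP[].
have /setIP[ye yS] : y \in e :&: S' by rewrite eS set11.
case/setUP=> [xe|]; last exact: IH.
apply: (connect_trans (IH y sE yS)).
apply: (@connect_trans _ _ (inr (exist _ e eH))); exact: connect1.
Qed.

(** The last glued hyperedge meets the earlier ones only at [x]. In a longer cycle through it, both
    its neighbours would lie on earlier hyperedges, hence both equal [x]. Cycles avoiding it are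
    covered by induction, which is why the hypothesis bears only on the hyperedges of [c]. *)
Lemma stacked_acyclic E S (c : seq (V + {e | e \in hyperedges H})) :
  stacked o E S ->
  (forall a : {e | e \in hyperedges H}, inr a \in c -> val a \in E) ->
  ucycle inc c ->
  (size c <= 2)%N.
Proof.
move=> st; elim: st c => [|E' S' e x st IH eS] c cE uc.
  case: c uc cE => [|[x|a] [|[y|b] c]] //= /andP[/= p _] cE //; exfalso.
  - by have := cE b; rewrite !inE eqxx orbT => /(_ isT).
  - by have := cE a; rewrite !inE eqxx => /(_ isT).
case: (boolP [exists a, (inr a \in c) && (val a == e)]); last first.
  rewrite negb_exists => /forallP nc; apply: (IH c) => // a ac.
  have /setU1P[ae|//] := cE a ac.
  by have := nc a; rewrite ac ae eqxx.
case/existsP=> a /andP[ac /eqP ae]; rewrite leqNgt; apply/negP => lt2.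
have [i c' dc] := rot_to ac.
have uc' : ucycle inc (inr a :: c') by rewrite -dc rot_ucycle.
have cE1 b : inr b \in c' -> b != a -> val b \in E'.
  move=> bc nba; have /cE/setU1P[bae|//] : inr b \in c.
    by rewrite -(mem_rot i) dc inE bc orbT.
  by case/eqP: nba; apply: val_inj; rewrite bae ae.
have key (y : V) (b : {e | e \in hyperedges H}) : inr b \in c' -> b != a ->
    y \in val b -> y \in e -> y = x.
  move=> bc nba yb ye; apply/set1P; rewrite -eS inE ye.
  exact: (subsetP (stacked_sub st (cE1 b bc nba))).
have sc : (2 < size (inr a :: c'))%N by rewrite -dc size_rot.
case/andP: uc' => pc /= /andP[nac uqc].
have nb b : inr b \in c' -> b != a by apply: contraTneq => ->.
case: c' {dc} sc pc nac uqc cE1 key nb => [|[y|?] [|[?|b] c2]] //= _.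
  by rewrite andbF.
case/and3P=> ya yb; rewrite rcons_path => /andP[pc2 la].
move=> _ /andP[nyc _] cE1 key nb.
have yx : y = x.
  have bc : inr b \in [:: inl y, inr b & c2] by rewrite !inE eqxx orbT.
  by apply: (key y b bc (nb b bc) yb); rewrite -ae.
case/lastP: c2 pc2 la nyc cE1 key nb => [|c2 z] //.
rewrite last_rcons rcons_path => /andP[pc2].
case: z => [z|?] //=; case lc: (last _ _) => [?|b'] //= zb' za nyc _ key nb.
have bc : inr b' \in inl y :: inr b :: rcons c2 (inl z).
  have := mem_last (inr b) c2; rewrite lc => b'c.
  by rewrite in_cons -rcons_cons mem_rcons in_cons b'c !orbT.
have zx : z = x by apply: (key z b' bc (nb b' bc) zb'); rewrite -ae.
by case/negP: nyc; rewrite yx zx inE mem_rcons mem_head orbT.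
Qed.

Lemma stacked_is_tree : stacked o (hyperedges H) setT -> is_tree inc.
Proof.
move=> st; split.
- by apply/card_gt0P; exists (inl o).
- have co (x : V + {e | e \in hyperedges H}) : connect inc (inl o) x.
    case: x => [x|[e eE]]; first exact: (stacked_connect st).
    have [x xe] := stacked_neq0 st eE.
    by apply: (@connect_trans _ _ (inl x)); [exact: (stacked_connect st) | exact: connect1].
  move=> y z; apply: connect_trans (co z).
  by rewrite (sym_connect_sym (@incidence_sym k H)).
- by move=> c; apply: stacked_acyclic st _ => e _; apply: (valP e).
Qed.

End StackedTree.
End Hypertree.

(** * Closed walks as runs of a stack machine *)

Lemma sum_tuple_cons (T : finType) m (F : seq T -> nat) :
  (\sum_(z : m.+1.-tuple T) F z = \sum_(a : T) \sum_(z : m.-tuple T) F (a :: z))%N.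
Proof.
rewrite pair_big /=.
rewrite (reindex (fun a : T * m.-tuple T => [tuple of a.1 :: a.2])) //=.
exists (fun z : m.+1.-tuple T => (thead z, [tuple of behead z])).
  by move=> [a z] _ /=; congr pair; apply: val_inj.
by move=> z _; rewrite -tuple_eta.
Qed.

Lemma card_tuple_cons (T : finType) m (P : pred (seq T)) :
  #|[set z : m.+1.-tuple T | P z]| =
  (\sum_(a : T) #|[set z : m.-tuple T | P (a :: z)]|)%N.
Proof.
rewrite -sum1dep_card big_mkcond (sum_tuple_cons m (fun z => if P z then 1 else 0)%N).
apply: eq_bigr => a _.
by rewrite -sum1dep_card [RHS]big_mkcond.
Qed.

Section Machine.
Variables (V : finType) (q : nat).
Implicit Types (e U : {set V}) (o u v x y : V) (st z : seq (V * {set V})).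

(* A closed walk crossing every hyperedge of a hypertree exactly twice, read as
   the run of a stack machine.  The stack [st] holds the vertices strictly below
   the root on the path to the current vertex, each one with the hyperedge
   leading to it; [U] is the set of vertices lying on no hyperedge crossed so
   far.  A step [(v, e)] goes to [v] through [e], which is either a new
   hyperedge or the one on top of the stack. *)
Definition current o st : V := (head (o, set0) st).1.

(** The uniformity p is [q.+2]: besides the current vertex and the target, a new hyperedge takes [q]
    further vertices from [U]. *)
Definition up_step o st U (a : V * {set V}) : bool :=
  [&& a.1 \in U, a.1 \in a.2, current o st \in a.2,
      a.2 \subset current o st |: U & #|a.2| == q.+2].

Definition down_step o st (a : V * {set V}) : bool :=
  if st is b :: st' then a == (current o st', b.2) else false.

Fixpoint run o st U z : bool :=
  if z is a :: z' then
    up_step o st U a && run o (a :: st) (U :\: a.2) z' ||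
    down_step o st a && run o (behead st) U z'
  else (st == [::]) && (U == set0).

Definition visited o st U : bool :=
  (o \notin U) && all (fun a : V * {set V} => (a.1 \notin U) && [disjoint a.2 & U]) st.

Lemma visited_current o st U : visited o st U -> current o st \notin U.
Proof. by case: st => [|a st] /andP[oU] //= /andP[/andP[]]. Qed.

Lemma visited_up o st U a : visited o st U -> up_step o st U a ->
  visited o (a :: st) (U :\: a.2).
Proof.
case/andP=> oU sU /and5P[aU aa _ _ _]; apply/and3P; split.
- by rewrite inE (negPf oU) andbF.
- by rewrite inE aa /= disjoint_sym disjoints_subset setDE subsetIr.
- apply: sub_all sU => b /andP[bU bd]; rewrite inE (negPf bU) andbF /=.
  by apply: disjointWr bd; apply: subsetDl.
Qed.

Lemma visited_down o st U : visited o st U -> visited o (behead st) U.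
Proof. by case: st => [|a st] //= /andP[oU /andP[_]]; rewrite /visited oU. Qed.

(** A new hyperedge contains an unvisited vertex, a stacked one contains none. Hence the disjunction
    in [run] is exclusive, and runs are counted by adding the two branches. *)
Lemma up_not_down o st U a : visited o st U -> up_step o st U a ->
  down_step o st a = false.
Proof.
case: st => [|b st] //= /andP[_ /= /andP[/andP[_ db] _]] /and5P[aU aa _ _ _].
apply/negP=> /eqP ae; move: db; rewrite disjoint_subset => /subsetP/(_ a.1).
have <- : a.2 = b.2 by rewrite ae.
by move=> /(_ aa); rewrite inE aU.
Qed.

Lemma card_up_rest o st U a : visited o st U -> up_step o st U a ->
  #|U :\: a.2| = (#|U| - q.+1)%N.
Proof.
move=> /visited_current cU /and5P[aU aa ca /subsetP sa /eqP card_a].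
rewrite cardsD; congr (_ - _)%N; have -> : U :&: a.2 = a.2 :\ current o st.
  apply/setP=> x; rewrite !inE; case: eqVneq => [->|nx]; first by rewrite (negPf cU).
  case xa: (x \in a.2) => /=; rewrite ?andbF // andbT.
  by have := sa x xa; rewrite !inE (negPf nx).
apply/eqP; rewrite -(eqn_add2l 1).
by have := cardsD1 (current o st) a.2; rewrite ca card_a => <-.
Qed.

(** Choose the target [v] in [U], then a set [B] of [q] other new vertices in [U :\ v]; the
    hyperedge is [c |: (v |: B)], with [c] the current vertex. *)
Lemma card_up_step o st U : visited o st U ->
  #|[set a | up_step o st U a]| = (#|U| * 'C(#|U|.-1, q))%N.
Proof.
move=> /visited_current; set c := current o st => cU.
rewrite -sum1dep_card big_mkcond /= -(pair_bigA _ (fun v e =>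
  if up_step o st U (v, e) then 1 else 0)%N) /= -sum_nat_const [RHS]big_mkcond.
apply: eq_bigr => v _; rewrite -big_mkcond sum1dep_card /up_step -/c /=.
case: ifP => [vU|_]; last by apply: eq_card0 => e; rewrite inE.
have nvc : v != c by apply: contraNneq cU => <-.
have -> : #|U|.-1 = #|U :\ v| by rewrite (cardsD1 v U) vU.
rewrite -cards_draws -(card_in_imset (f := fun B => c |: (v |: B))).
  apply: eq_card => e; rewrite inE /=; apply/idP/imsetP.
    case/and4P=> ve ce /subsetP se /eqP card_e; exists (e :\ c :\ v).
      rewrite !inE; apply/andP; split.
        apply/subsetP=> x; rewrite !inE => /and3P[-> nxc /se].
        by rewrite !inE (negPf nxc).
      have := cardsD1 c e; have := cardsD1 v (e :\ c).
      rewrite ce !inE ve nvc card_e => /= -> /eqP.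
      by rewrite !add1n !eqSS eq_sym.
    by rewrite !setD1K // !inE ?nvc.
  case=> B; rewrite !inE => /andP[sB /eqP card_B] ->.
  rewrite !inE !eqxx orbT /=; apply/andP; split.
    rewrite setUS // subUset sub1set vU.
    by apply: subset_trans sB (subsetDl _ _).
  have vB : v \notin B by apply/negP=> /(subsetP sB); rewrite !inE eqxx.
  have cB : c \notin B.
    by apply: contraNN cU => /(subsetP sB); rewrite !inE => /andP[].
  by rewrite !cardsU1 !inE (eq_sym c) (negPf nvc) cB vB card_B.
move=> B B'; rewrite !inE => /andP[sB _] /andP[sB' _] eB.
have H (A : {set V}) : A \subset U :\ v -> A = (c |: (v |: A)) :\ c :\ v.
  move=> sA; apply/setP=> x; rewrite !inE.
  case xA: (x \in A); last by case: (x == v); case: (x == c).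
  have := subsetP sA x xA; rewrite !inE => /andP[-> xU]; rewrite !orbT /= andbT.
  by apply/esym; apply: contraTneq xU => ->.
by rewrite (H B sB) (H B' sB') eB.
Qed.

(** The arguments are the steps left, the stack height and the number of unvisited vertices; by
    [card_run], the number of runs depends on nothing else. *)
Fixpoint run_count (m h u : nat) : nat :=
  if m is m'.+1 then
    u * 'C(u.-1, q) * run_count m' h.+1 (u - q.+1) +
    (if h is h'.+1 then run_count m' h' u else 0)
  else (h == 0) && (u == 0).

Lemma card_run m o st U : visited o st U ->
  #|[set z : m.-tuple _ | run o st U z]| = run_count m (size st) #|U|.
Proof.
elim: m st U => [|m IHm] st U vis.
  rewrite /= size_eq0 cards_eq0; case c: (_ && _).
    apply/eqP/cards1P; exists [tuple]; apply/setP=> z.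
    by rewrite !inE tuple0 /= c; apply/esym/eqP; apply: val_inj.
  by apply: eq_card0 => z; rewrite inE tuple0 /= c.
rewrite card_tuple_cons.
transitivity (\sum_(a | up_step o st U a) run_count m (size st).+1 (#|U| - q.+1) +
  \sum_(a | down_step o st a) run_count m (size st).-1 #|U|)%N.
  rewrite [in RHS]big_mkcond [X in (_ + X)%N]big_mkcond -big_split; apply: eq_bigr => a _ /=.
  case: ifP => up.
    rewrite (up_not_down vis up) addn0 -(card_up_rest vis up).
    by rewrite -(IHm (a :: st) _ (visited_up vis up)); apply: eq_card => z;
       rewrite !inE orbF.
  rewrite add0n; case: ifP => dn; last by apply: eq_card0 => z; rewrite inE.
  by rewrite -size_behead -(IHm _ _ (visited_down vis)).
rewrite !sum_nat_cond_const card_up_step //=; congr addn.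
case: st {vis} => [|b st] /=; last first.
  rewrite (eq_card (B := [set (current o st, b.2)])) ?cards1 ?mul1n // => a.
  by rewrite !inE.
by apply/eqP; rewrite muln_eq0 cards_eq0; apply/orP; left; apply/eqP/setP=> a; rewrite !inE.
Qed.

(** With [j] up steps there are [h + j] down steps, and each up step uses up [q.+1] vertices. *)
Lemma run_count_neq0 (m h u : nat) : run_count m h u != 0 ->
  exists2 j, m = (h + j.*2)%N & u = (j * q.+1)%N.
Proof.
elim: m h u => [|m IHm] h u /=.
  by case: h => [|h]; case: u => [|u] // _; exists 0.
rewrite addn_eq0 negb_and => /orP[|].
  rewrite !muln_eq0 !negb_or -!lt0n bin_gt0 => /andP[/andP[u0 qu]].
  by rewrite lt0n => /IHm[j -> uj]; exists j.+1; lia.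
by case: h => // h /IHm[j -> ->]; exists j => //; lia.
Qed.

(* Paths from height [h] to height 0 in [m] steps staying nonnegative. *)
Fixpoint ballot (m h : nat) : nat :=
  if m is m'.+1 then
    ballot m' h.+1 + (if h is h'.+1 then ballot m' h' else 0)
  else (h == 0).

Lemma ballot_eq0 (m h : nat) : m < h -> ballot m h = 0.
Proof.
elim: m h => [|m IHm] [|h] //= mh.
by rewrite !IHm //; lia.
Qed.

(** With u vertices left, an up step has u C(u-1, q) = u! / ((u-q-1)! q!) choices. The product
    telescopes along any run, wherever the up steps occur, so that only the number of height
    profiles remains. *)
Lemma run_countE (m h j : nat) : m = (h + j.*2)%N ->
  (run_count m h (j * q.+1) * q`! ^ j = ballot m h * (j * q.+1)`!)%N.
Proof.
elim: m h j => [|m IHm] h j mE.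
  by have [-> ->] : h = 0 /\ j = 0 by lia.
have down : ((if h is h'.+1 then run_count m h' (j * q.+1) else 0) * q`! ^ j =
  (if h is h'.+1 then ballot m h' else 0) * (j * q.+1)`!)%N.
  by case: h mE => // h mE; apply: IHm; lia.
rewrite /= !mulnDl down; congr addn; case: j {down} mE => [|j] mE.
  by rewrite mul0n /= ballot_eq0 //; lia.
have -> : (j.+1 * q.+1 - q.+1 = j * q.+1)%N by lia.
have IH : (run_count m h.+1 (j * q.+1) * q`! ^ j = ballot m h.+1 * (j * q.+1)`!)%N.
  by apply: IHm; lia.
rewrite expnS -mulnA (mulnCA _ q`!) IH.
have -> : (j.+1 * q.+1 = (q + j * q.+1).+1)%N by lia.
have := @bin_fact (q + j * q.+1) q (leq_addr _ _); rewrite addKn => F.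
by rewrite succnK factS -F; ring.
Qed.

(** Reflection principle, free of truncated subtraction: among the C(m, j) paths with [j] up steps,
    those that become negative number C(m, j-1). The proof is an induction by Pascal's rule. *)
Lemma ballot_bin (m h j : nat) : m = (h + j.*2)%N ->
  (ballot m h + (if j is j'.+1 then 'C(m, j') else 0) = 'C(m, j))%N.
Proof.
elim: m h j => [|m IHm] h j mE; first by have [-> ->] : h = 0 /\ j = 0 by lia.
case: j mE => [|j] mE.
  case: h mE => [|h] mE; first by lia.
  have := IHm h 0 ltac:(lia); rewrite /= !bin0 (@ballot_eq0 m h.+2) ?addn0 ?add0n //; lia.
rewrite /= binS; have := IHm h.+1 j; case: h mE => [|h] mE.
  (* At height 0 there is no down step; the symmetry of the middle binomials, [m] being 2j+1, makes
     up for it. *)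
  have -> : 'C(m, j.+1) = 'C(m, j) by rewrite -(@bin_sub _ j); [congr 'C(_, _)|]; lia.
  by move=> /(_ ltac:(lia)); case: j mE => [|j] mE; rewrite ?binS ?bin0; lia.
move=> /(_ ltac:(lia)); have := IHm h j.+1 ltac:(lia); rewrite /=.
by case: j mE => [|j] mE; rewrite ?binS ?bin0; lia.
Qed.

Lemma ballot_catalan (l : nat) : (ballot l.*2 0 * l.+1 = 'C(l.*2, l))%N.
Proof.
have := @ballot_bin l.*2 0 l erefl; case: l => // l.
have := mul_bin_left l.+1.*2 l.
by rewrite -addnn addSn addnS; nia.
Qed.

(** Catalan recursion in the shape, up to a factor 2, of the recursion [moment_rec] for even
    moments, with which it is matched at the end. *)
Lemma ballot_rec (l : nat) :
  (ballot l.+1.*2 0 * l.+2 = 2 * l.*2.+1 * ballot l.*2 0)%N.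
Proof.
have diag := mul_bin_diag l.*2.+2 l; have diag' := mul_bin_diag l.*2.+1 l.
have sym : 'C(l.*2.+1, l.+1) = 'C(l.*2.+1, l).
  by rewrite -(@bin_sub _ l); [congr 'C(_, _)|]; lia.
have := ballot_catalan l; have := ballot_catalan l.+1.
move: diag diag'; rewrite sym doubleS !succnK.
move: (ballot _ _) (ballot _ _) => c' c.
move: 'C(l.*2.+2, l.+1) 'C(l.*2.+1, l) 'C(l.*2, l) => B' X B e1 e2 e3 e4.
have e5 : B' = (2 * X)%N by nia.
by apply/eqP; rewrite -(eqn_pmul2l (ltn0Sn l)); apply/eqP; nia.
Qed.

End Machine.

(** * Runs as labelled walks on a hypertree *)

Section Runs.
Variables (V : finType) (q : nat).
Implicit Types (e U : {set V}) (o u v x y : V) (st z : seq (V * {set V})).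
Implicit Types (E : {set {set V}}) (w : seq V).
Local Notation run := (run q).
Local Notation up_step := (up_step q).

(** [walk_mult] with an arbitrary starting vertex, so that inductions along the walk can move it. *)
Definition crossings x w e : nat :=
  count (fun uv => (uv.1 \in e) && (uv.2 \in e)) (zip (x :: w) w).

Fixpoint steps_ok x z : bool :=
  if z is a :: z' then
    [&& x \in a.2, a.1 \in a.2, x != a.1, #|a.2| == q.+2 & steps_ok a.1 z']
  else true.

(** A down step crosses an old hyperedge again, so the facts that make the crossing legal have to be
    remembered on the stack. *)
Fixpoint stack_ok o st : bool :=
  if st is b :: st' then
    [&& current o st' \in b.2, b.1 \in b.2, current o st' != b.1, #|b.2| == q.+2
      & stack_ok o st']
  else true.

Lemma run_steps_ok o st U z : visited o st U -> stack_ok o st ->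
  run o st U z -> steps_ok (current o st) z.
Proof.
elim: z st U => //= a z IHz st U vis sok /orP[/andP[up r]|/andP[dn r]].
  have cU := visited_current vis.
  have {IHz} := IHz _ _ (visited_up vis up); rewrite /=.
  case/and5P: up => aU aa ca _ card_a; rewrite ca aa card_a sok /= andbT.
  have -> : current o st != a.1 by apply: contraNneq cU => ->.
  by move=> /(_ isT r).
case: st vis sok dn r => // b st vis /= /and5P[cb bb nb card_b sok] /eqP-> r.
rewrite /= cb bb card_b eq_sym nb /=.
exact: IHz (visited_down vis) sok r.
Qed.

Lemma run_last o st U z : run o st U z -> last (current o st) (unzip1 z) = o.
Proof.
elim: z st U => /= [|a z IHz] st U; first by case/andP=> /eqP->.
case/orP=> /andP[sa /IHz //]; case: st sa => // b st /eqP ->; exact: id.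
Qed.

(** The stack is empty at the end, so each hyperedge on it is crossed once more. A hyperedge meeting
    [U] is not discovered yet: it is either never crossed, or crossed once up and once down. *)
Lemma run_count_mem o st U z e : visited o st U -> run o st U z ->
  count_mem e (unzip2 z) = if [disjoint e & U] then count_mem e (unzip2 st)
                           else (e \in unzip2 z).*2.
Proof.
elim: z st U => /= [|a z IHz] st U vis.
  by case/andP=> /eqP-> /eqP->; rewrite disjoints_subset setC0 subsetT.
case/orP=> /andP[sa r].
  have {IHz r} := IHz _ _ (visited_up vis sa) r; rewrite /=.
  have dsub : [disjoint e & U] -> [disjoint e & U :\: a.2].
    by apply: disjointWr; apply: subsetDl.
  case/and5P: (sa) => aU aa _ _ _.
  have nda : ~~ [disjoint a.2 & U].
    by apply/negP; rewrite disjoint_subset => /subsetP/(_ _ aa); rewrite inE aU.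
  have nst : ~~ [disjoint e & U] -> count_mem e (unzip2 st) = 0.
    move=> ne; apply/count_memPn; apply: contra ne => /mapP[b bst ->].
    by case/andP: vis => _ /allP/(_ b bst) /andP[].
  rewrite [e \in _ :: _]in_cons; case: (eqVneq a.2 e) => [ae|ne] /=.
    subst e; rewrite (negPf nda) disjoint_sym disjoints_subset setDE subsetIr => ->.
    by rewrite nst.
  case de: [disjoint e & U]; first by rewrite dsub.
  case de': [disjoint e & _]; rewrite /= add0n // => c0.
  have c1 : count_mem e (unzip2 st) = 0 by rewrite nst ?de.
  have /negPf-> : e \notin unzip2 z by apply/count_memPn; rewrite c0.
  by rewrite c0.
have {IHz r} := IHz _ _ (visited_down vis) r.
case: st vis sa => // b st vis /eqP -> /=.
have db : [disjoint b.2 & U] by case/andP: vis => _ /andP[/andP[]].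
rewrite [e \in _ :: _]in_cons; case: (eqVneq b.2 e) => [<-|ne] /= ->.
  by rewrite db.
by [].
Qed.

(** Each up step glues its hyperedge, at the current vertex, to the set [E] of those discovered so
    far, which cover [~: U]; a down step adds nothing. A run ends with [U] empty, so everything is
    covered. *)
Lemma run_stacked o st U z E : visited o st U -> stacked o E (~: U) ->
  (forall e, e \in unzip2 st -> e \in E) -> run o st U z ->
  stacked o (E :|: [set e in unzip2 z]) setT.
Proof.
elim: z st U E => /= [|a z IHz] st U E vis sE stE.
  by case/andP=> _ /eqP U0; move: sE; rewrite U0 setC0 set_nil setU0.
have split_edges : E :|: [set e in a.2 :: unzip2 z] =
    (a.2 |: E) :|: [set e in unzip2 z] by rewrite set_cons setUCA setUA.
case/orP=> /andP[sa r]; rewrite split_edges.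
  apply: IHz (visited_up vis sa) _ _ r.
  - have -> : ~: (U :\: a.2) = a.2 :|: ~: U by rewrite setCD setUC.
    apply: (@StackedS _ _ _ _ _ (current o st)) => //.
    case/and5P: sa => _ _ ca /subsetP sa _.
    apply/setP=> x; rewrite !inE; apply/andP/eqP => [[xa xU]|->].
      by have /setU1P[//|xU'] := sa x xa; rewrite xU' in xU.
    by rewrite ca (visited_current vis).
  - by move=> e; rewrite !inE => /orP[->//|/stE->]; rewrite orbT.
case: st vis stE sa r => // b st vis stE /eqP-> r /=.
have /setUidPr -> : [set b.2] \subset E by rewrite sub1set stE // mem_head.
apply: IHz (visited_down vis) sE _ r => e est.
by apply: stE; rewrite inE est orbT.
Qed.

Definition linear_edges E : Prop := forall e e' u v, e \in E -> e' \in E ->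
  u != v -> u \in e -> v \in e -> u \in e' -> v \in e' -> e = e'.

Lemma crossings_steps x z E e : linear_edges E -> e \in E ->
  (forall e', e' \in unzip2 z -> e' \in E) -> steps_ok x z ->
  crossings x (unzip1 z) e = count_mem e (unzip2 z).
Proof.
move=> lE eE; elim: z x => //= a z IHz x zE /and5P[xa aa nx _ ok].
rewrite /crossings /= -/(crossings _ _ _) IHz //; last first.
  by move=> e' ez; apply: zE; rewrite inE ez orbT.
congr (nat_of_bool _ + _); apply/andP/eqP => [[xe ae]|<- //].
by apply: (lE _ _ x a.1) => //; apply: zE; rewrite mem_head.
Qed.

(** By linearity the endpoints of a step determine its hyperedge, so the vertices alone recover the
    labelled walk. *)
Lemma steps_inj x z z' E : linear_edges E ->
  (forall e, e \in unzip2 z -> e \in E) ->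
  (forall e, e \in unzip2 z' -> e \in E) ->
  steps_ok x z -> steps_ok x z' -> unzip1 z = unzip1 z' -> z = z'.
Proof.
move=> lE; elim: z z' x => [|[v e] z IHz] [|[v' e'] z'] x //= zE zE'.
case/and5P=> xe ve nx _ ok /and5P[xe' ve' _ _ ok'] [vv' zz'].
rewrite -{}vv' in ve' ok' *; congr ((_, _) :: _).
  by apply: (lE _ _ x v) => //; [apply: zE | apply: zE']; rewrite mem_head.
by apply: IHz ok ok' zz' => f fz; [apply: zE | apply: zE']; rewrite inE fz orbT.
Qed.

Lemma steps_card x z e : steps_ok x z -> e \in unzip2 z -> #|e| = q.+2.
Proof.
elim: z x => //= a z IHz x /and5P[_ _ _ /eqP card_a ok].
by rewrite inE => /orP[/eqP->//|]; apply: IHz ok.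
Qed.

Lemma size_sum_count (z : seq (V * {set V})) :
  size z = (\sum_(e in [set e in unzip2 z]) count_mem e (unzip2 z))%N.
Proof.
rewrite -(size_map snd) -/unzip2; move: (unzip2 z) => s.
rewrite -[LHS]count_predT (eq_bigl (fun e => e \in s)); last by move=> e; rewrite inE.
transitivity (\sum_(e : {set V}) count_mem e s)%N; last first.
  rewrite [RHS]big_mkcond; apply: eq_bigr => e _; case: ifP => // /negbT es.
  exact/count_memPn.
elim: s => [|f s IHs] /=; first by rewrite big1.
rewrite big_split /= -IHs; congr addn; rewrite (bigD1 f) //= eqxx big1 ?addn0 // => e /negPf.
by rewrite eq_sym => ->.
Qed.

End Runs.

(** * Bijection between runs and walks crossing every hyperedge twice *)

Section Bijection.
Variables (V : finType) (q k : nat).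
Local Notation run := (run q).

Definition twice_crossed : {set rooted_fat V k * k.-tuple V} :=
  [set a | [&& a.1 \in fat_hypertrees V k q.+2, a.2 \in closed_walks a.1
             & [forall e in hyperedges a.1, mult a.1 e == 2]]].

Definition full_runs : {set V * k.-tuple (V * {set V})} :=
  [set a : V * k.-tuple (V * {set V}) | run a.1 [::] [set~ a.1] a.2].

Definition run_walk (a : V * k.-tuple (V * {set V})) :
    rooted_fat V k * k.-tuple V :=
  (([ffun e : {set V} => if e \in unzip2 a.2 then inord 2 else ord0], a.1),
   map_tuple fst a.2).

Lemma root_visited (o : V) : visited o [::] [set~ o].
Proof. by rewrite /visited !inE eqxx. Qed.

(** A single step cannot leave and return. This excludes [k = 1], where [inord 2] in [run_walk]
    would not be 2; for [k = 0] there is no hyperedge at all. *)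
Lemma run_size (o : V) z : run o [::] [set~ o] z -> size z != 1.
Proof.
by case: z => [|a [|b z]] //=; rewrite !andbF.
Qed.

Lemma mult_run_walk (a : V * k.-tuple (V * {set V})) (e : {set V}) :
  a \in full_runs -> mult (run_walk a).1 e = if e \in unzip2 a.2 then 2 else 0.
Proof.
rewrite inE => /run_size; rewrite size_tuple => k1.
rewrite /mult /= ffunE; case: ifP => // ez; rewrite inordK // ltnS.
by case: k k1 a ez => [|[|m]] // _ [o z]; rewrite tuple0.
Qed.

Lemma hyperedges_run_walk (a : V * k.-tuple (V * {set V})) : a \in full_runs ->
  hyperedges (run_walk a).1 = [set e in unzip2 a.2].
Proof.
move=> aR; apply/setP=> e; rewrite !inE mult_run_walk //.
by case: (e \in _).
Qed.

Lemma run_walk_tree (a : V * k.-tuple (V * {set V})) : a \in full_runs ->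
  is_tree (@incidence V k (run_walk a).1).
Proof.
move=> aR; apply: (@stacked_is_tree _ _ _ a.1); rewrite hyperedges_run_walk //.
rewrite -[X in stacked _ X](set0U [set e in unzip2 a.2]).
move: aR; rewrite inE; apply: run_stacked => //; first exact: root_visited.
by rewrite setCK; apply: Stacked0.
Qed.

Lemma run_walk_linear (a : V * k.-tuple (V * {set V})) : a \in full_runs ->
  linear_edges [set e in unzip2 a.2].
Proof.
move=> aR e e' u v; rewrite -hyperedges_run_walk // => eE e'E.
exact: tree_linear (run_walk_tree aR) eE e'E.
Qed.

Lemma run_walk_steps (a : V * k.-tuple (V * {set V})) : a \in full_runs ->
  steps_ok q a.1 a.2.
Proof. by rewrite inE; apply: (run_steps_ok (root_visited _)). Qed.

Lemma run_walk_inj : {in full_runs &, injective run_walk}.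
Proof.
move=> [o z] [o' z'] aR aR' [/ffunP eE oo' zz']; rewrite -{}oo' in aR' eE *.
congr pair; apply: val_inj => /=.
have E := hyperedges_run_walk aR; have E' := hyperedges_run_walk aR'.
have EE e : (e \in unzip2 z') = (e \in unzip2 z).
  have := mult_run_walk e aR; have := mult_run_walk e aR'.
  by rewrite /mult /= eE => ->; case: (e \in _); case: (e \in _).
apply: (steps_inj (run_walk_linear aR)) zz'.
- by move=> e; rewrite inE.
- by move=> e; rewrite inE /= EE.
- exact: run_walk_steps aR.
- exact: run_walk_steps aR'.
Qed.

Lemma steps_path (H : rooted_fat V k) x z : steps_ok q x z ->
  (forall e, e \in unzip2 z -> e \in hyperedges H) ->
  path (@clique_adj V k H) x (unzip1 z).
Proof.
elim: z x => //= a z IHz x /and5P[xa aa nx _ ok] zE; apply/andP; split.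
  by rewrite /clique_adj nx; apply/existsP; exists a.2; rewrite xa aa zE ?mem_head.
by apply: IHz ok _ => e ez; apply: zE; rewrite inE ez orbT.
Qed.

Lemma run_walk_crossed a : a \in full_runs -> run_walk a \in twice_crossed.
Proof.
move=> aR; have E := hyperedges_run_walk aR; have sok := run_walk_steps aR.
have mem_E e : (e \in hyperedges (run_walk a).1) = (e \in unzip2 a.2).
  by rewrite E inE.
have two e : e \in unzip2 a.2 -> count_mem e (unzip2 a.2) = 2.
  move=> ez; move: aR; rewrite inE => r.
  rewrite (run_count_mem e (root_visited _) r) ez /=; case: ifP => // d.
  have : count_mem e (unzip2 a.2) == 0.
    by rewrite (run_count_mem e (root_visited _) r) d.
  by move/eqP/count_memPn; rewrite ez.
rewrite inE; apply/and3P; split.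
- rewrite inE; apply/and4P; split.
  + exact/asboolP/run_walk_tree.
  + by apply/'forall_implyP=> e; rewrite mem_E => /(steps_card sok) ->.
  + by apply/'forall_implyP=> e; rewrite mem_E mult_run_walk // => ->.
  + rewrite -[X in _ == X](size_tuple a.2) size_sum_count E; apply/eqP.
    by apply: eq_bigr => e; rewrite inE => ez; rewrite two // mult_run_walk // ez.
- rewrite inE; apply/and3P; split.
  + by apply: steps_path sok _ => e; rewrite mem_E.
  + by move: aR; rewrite inE => /run_last /eqP.
  + apply/'forall_implyP=> e; rewrite mem_E => ez.
    rewrite mult_run_walk // ez -(two e ez) /walk_mult /steps -/(crossings _ _ _).
    apply/eqP; apply: crossings_steps (run_walk_linear aR) _ _ sok => //.
    * by rewrite inE.
    * by move=> e'; rewrite inE.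
- by apply/'forall_implyP=> e; rewrite mem_E mult_run_walk // => ->.
Qed.

Lemma clique_adjP (H : rooted_fat V k) u v :
  reflect (u != v /\ exists e, [/\ e \in hyperedges H, u \in e & v \in e])
    (clique_adj H u v).
Proof.
apply: (iffP andP) => -[nuv]; first by move=> /(edge_adjP (hyperedges H)).
by move=> uv; split=> //; apply/(edge_adjP (hyperedges H)).
Qed.

(** Combined with [tree_cut], this forces a walk to come back through a hyperedge at the vertex
    where it entered it. *)
Lemma crossings_connect (H : rooted_fat V k) x w e : path (@clique_adj V k H) x w ->
  crossings x w e = 0 ->
  connect (edge_adj (hyperedges H :\ e)) x (last x w).
Proof.
elim: w x => //= v w IHw x /andP[/clique_adjP[_ [f [fE xf vf]]] pw].
rewrite /crossings /= -/(crossings _ _ _) => /eqP.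
rewrite addn_eq0 eqb0 => /andP[nxv /eqP/(IHw _ pw)]; apply: connect_trans.
apply: connect1; apply/edge_adjP; exists f; split=> //.
by rewrite in_setD1 fE andbT; apply: contraNneq nxv => <-; rewrite xf vf.
Qed.

(* Each vertex of the stack was new when its hyperedge was first crossed. *)
Fixpoint fresh (st : seq (V * {set V})) : bool :=
  if st is b :: st' then
    all (fun a : V * {set V} => b.1 \notin a.2) st' && fresh st'
  else true.

Lemma stack_connect (o : V) st (E : {set {set V}}) : stack_ok q o st ->
  (forall e, e \in unzip2 st -> e \in E) ->
  connect (edge_adj E) o (current o st).
Proof.
elim: st => //= b st IHst /and5P[cb bb _ _ ok] stE.
apply: (@connect_trans _ _ (current o st)).
  by apply: IHst ok _ => e est; apply: stE; rewrite inE est orbT.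
by apply: connect1; apply/edge_adjP; exists b.2; rewrite stE ?mem_head.
Qed.

(** Surjectivity of [run_walk], by induction on the rest [w] of the walk. [E0] is the set of
    hyperedges crossed so far: those on the stack have one crossing left, the others in [E0] none,
    and those outside [E0] two. A step through a hyperedge of [E0] must be a down step, any other an
    up step. *)
Lemma crossed_run (H : rooted_fat V k) (o : V) st (U : {set V}) (E0 : {set {set V}}) w :
    is_tree (@incidence V k H) ->
    (forall e, e \in hyperedges H -> #|e| = q.+2) ->
    E0 \subset hyperedges H ->
    (forall y, (y \notin U) = (y == o) || [exists e in E0, y \in e]) ->
    (forall y, y \notin U -> connect (edge_adj E0) o y) ->
    stack_ok q o st -> fresh st -> (forall e, e \in unzip2 st -> e \in E0) ->
    path (@clique_adj V k H) (current o st) w -> last (current o st) w = o ->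
    (forall e, e \in hyperedges H -> crossings (current o st) w e =
       if e \in E0 then nat_of_bool (e \in unzip2 st) else 2) ->
  exists z, [/\ unzip1 z = w, run o st U z,
    forall e, e \in unzip2 z -> e \in hyperedges H &
    forall e, e \in hyperedges H -> e \notin E0 -> e \in unzip2 z].
Proof.
move=> Ht Hp; elim: w st U E0 => [|v w IHw] st U E0 sE0 US co sok fr stE0 /=.
  move=> _ cuo cr.
  have allE e : e \in hyperedges H -> e \in E0.
    by move=> eE; have := cr e eE; case: ifP.
  exists [::]; split=> //=; last by move=> e eE; rewrite allE.
  apply/andP; split.
    (* A nonempty stack would leave a crossing of its top hyperedge still due. *)
    case: st {sok fr co} stE0 cr {cuo} => // b st stE0 cr.
    have bE : b.2 \in E0 by apply: stE0; rewrite mem_head.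
    have := cr b.2 (subsetP sE0 _ bE).
    by rewrite bE /= mem_head /crossings.
  apply/eqP/setP=> y; rewrite inE; apply/negbTE; rewrite US.
  case: (eqVneq o y) => [oy //|noy].
  have [e eE ye] := tree_cover Ht noy; apply/orP; right.
  by apply/existsP; exists e; rewrite allE.
case/andP=> /clique_adjP[nxv [e [eE xe ve]]] pw lw cr.
have lin f : f \in hyperedges H -> (current o st \in f) && (v \in f) = (e == f).
  move=> fE; apply/andP/eqP => [[xf vf]|<- //].
  exact: (tree_linear Ht eE fE nxv).
have cr' f : f \in hyperedges H -> ((e == f) + crossings v w f =
    if f \in E0 then nat_of_bool (f \in unzip2 st) else 2)%N.
  by move=> fE; rewrite -cr // -lin.
have cU : current o st \notin U.
  rewrite US; case: st sok stE0 {fr co pw lw cr cr' lin nxv xe} => [|b st] sok stE0.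
    by rewrite eqxx.
  apply/orP; right; apply/existsP; exists b.2; rewrite stE0 ?mem_head //=.
  by case/and5P: sok.
case: (boolP (e \in E0)) => [eE0|neE0].
  have := cr' e eE; rewrite eqxx eE0; case est: (e \in _) => // -[c0].
  case: st est sok fr xe nxv {lin cr cU} stE0 cr' => // b st est sok fr xe nxv stE0 cr'.
  case/and5P: sok => cb bb nb card_b sok; case/andP: fr => /allP fb fr.
  (* The current vertex lies on [e] but, being fresh, on no hyperedge further down the stack; so [e]
     is the top one. *)
  have nst a : a \in st -> a.2 != e.
    by move=> /fb; apply: contraNneq => ->.
  have eb : e = b.2.
    move: est; rewrite inE => /orP[/eqP//|/mapP[a /nst + ea]].
    by rewrite ea eqxx.
  (* This is the last crossing of [e], so the rest of the walk joins [v] to [o] without [e], and the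
     stack below joins [o] to the previous vertex without [e]; both ends lie on [e]. *)
  have vE : v = current o st.
    apply: (tree_cut Ht eE) => //; first by rewrite eb.
    apply: (@connect_trans _ _ o).
      by rewrite -[X in connect _ _ X]lw; apply: crossings_connect.
    apply: stack_connect sok _ => f /mapP[a ast ->]; rewrite in_setD1 nst //=.
    by apply: (subsetP sE0); apply: stE0; rewrite inE map_f ?orbT.
  have nest : e \notin unzip2 st by apply/negP=> /mapP[a /nst + ea]; rewrite ea eqxx.
  have stE0' f : f \in unzip2 st -> f \in E0.
    by move=> fst; apply: stE0; rewrite inE fst orbT.
  rewrite vE in pw lw cr'.
  have [f fE|z [zw r zE zE0]] := IHw st U E0 sE0 US co sok fr stE0' pw lw.
    have := cr' f fE; rewrite inE -eb eq_sym.
    case: (eqVneq f e) => [->|_] //=; rewrite eE0 (negPf nest).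
    by rewrite add1n => -[].
  exists ((v, e) :: z); split=> /=; first by rewrite zw.
  - by apply/orP; right; rewrite r vE eb eqxx.
  - by move=> f; rewrite inE => /orP[/eqP->//|]; apply: zE.
  - by move=> f fE nf; rewrite inE zE0 ?orbT.
(* Visited vertices are joined through [E0], which avoids the new hyperedge [e]; hence [e] meets
   them only at the current vertex. *)
have nocc y : y \in e -> y \notin U -> y = current o st.
  move=> ye yU; apply: (tree_cut Ht eE) => //.
  have sE : E0 \subset hyperedges H :\ e by rewrite subsetD1 sE0.
  apply: (@connect_trans _ _ o); apply: edge_connectS sE _; last exact: co.
  by rewrite edge_connect_sym co.
have vU : v \in U by apply: contraNT nxv => /(nocc v ve) ->.
have [| | | | | | | | |z [zw r zE zE0]] // := IHw ((v, e) :: st) (U :\: e) (e |: E0).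
- by rewrite subUset sub1set eE.
- move=> y; rewrite inE negb_and negbK US; case ye: (y \in e) => /=.
    apply/esym/orP; right; apply/existsP; exists e; by rewrite setU11.
  case: (y == o) => //=; apply: eq_existsb => f; rewrite !inE.
  by case: eqVneq => // ->; rewrite ye andbF.
- move=> y; rewrite inE negb_and negbK => /orP[ye|yU].
    apply: (connect_trans (edge_connectS (subsetUr _ _) (co _ cU))).
    by apply: connect1; apply/edge_adjP; exists e; rewrite setU11.
  exact: edge_connectS (subsetUr _ _) (co _ yU).
- by rewrite /= xe ve nxv Hp ?eqxx.
- rewrite /= fr andbT; apply/allP=> a ast; apply: contraTN vU => va.
  rewrite US; apply/orP; right; apply/existsP; exists a.2.
  by rewrite stE0 // map_f.
- by move=> f; rewrite !inE => /orP[->//|/stE0->]; rewrite orbT.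
- move=> f fE; have := cr' f fE; rewrite /= !inE eq_sym.
  by case: (eqVneq e f) => [<-|_] //=; rewrite (negPf neE0) => -[].
exists ((v, e) :: z); split=> /=.
- by rewrite zw.
- apply/orP; left; rewrite r andbT; apply/and5P; split=> //=; last by rewrite Hp.
  apply/subsetP=> y ye; rewrite !inE; case yU: (y \in U); rewrite ?orbT // orbF.
  by apply/eqP/nocc; rewrite ?yU.
- by move=> f; rewrite inE => /orP[/eqP->//|]; apply: zE.
- move=> f fE nf; rewrite inE; case: eqVneq => //= nfe; apply: zE0 => //.
  by rewrite !inE negb_or nfe.
Qed.

Lemma twice_crossed_run_walk b : b \in twice_crossed ->
  exists2 a, a \in full_runs & b = run_walk a.
Proof.
case: b => -[m o] w; set H : rooted_fat V k := (m, o); rewrite inE /=.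
case/and3P; rewrite inE => /and4P[/asboolP Ht /'forall_implyP Hp _ _].
rewrite inE => /and3P[pw /eqP lw /'forall_implyP Hw] /'forall_implyP H2.
have Hp' e : e \in hyperedges H -> #|e| = q.+2 by move=> /Hp /eqP.
have US (y : V) : (y \notin [set~ o]) =
    (y == o) || [exists e in (set0 : {set {set V}}), y \in e].
  rewrite !inE negbK -[LHS]orbF; congr orb; apply/esym/existsP=> -[e].
  by rewrite inE.
have co (y : V) : y \notin [set~ o] -> connect (edge_adj set0) o y.
  by rewrite !inE negbK => /eqP->; apply: connect0.
have cr e : e \in hyperedges H -> crossings o w e =
    if e \in (set0 : {set {set V}}) then nat_of_bool (e \in [::]) else 2.
  by move=> eE; rewrite inE -(eqP (H2 e eE)) -(eqP (Hw e eE)).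
have [z [zw r zE zE0]] := @crossed_run H o [::] [set~ o] set0 w Ht Hp'
  (sub0set _) US co isT isT (fun e (h : e \in [::]) => False_ind _ (notF h)) pw lw cr.
have sz : size z == k by rewrite -(size_map fst) -/unzip1 zw size_tuple.
have aR : (o, Tuple sz) \in full_runs by rewrite inE.
exists (o, Tuple sz) => //; congr (_, _); last exact: val_inj.
congr (_, _); apply/ffunP=> e; apply: val_inj.
have := mult_run_walk e aR; rewrite /mult /= => ->.
case: ifP => [/zE eH|nez]; first exact/eqP/(H2 e).
apply/eqP; apply: contraFT nez => ne0; apply: zE0; first by rewrite inE.
by rewrite inE.
Qed.

Lemma card_twice_crossed : #|twice_crossed| = (#|V| * run_count q k 0 #|V|.-1)%N.
Proof.
transitivity #|full_runs|.
  rewrite -(card_in_imset run_walk_inj); apply: eq_card => -[H w].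
  apply/idP/imsetP => [|[a aR ->]]; last exact: run_walk_crossed.
  exact: twice_crossed_run_walk.
rewrite -sum1dep_card big_mkcond /= -(pair_bigA _ (fun o z =>
  if run o [::] [set~ o] (tval z) then 1 else 0)%N) /= -sum_nat_const.
apply: eq_bigr => o _; rewrite -big_mkcond sum1dep_card card_run ?root_visited //.
by rewrite cardsC1.
Qed.

End Bijection.

(** * From labelled hypertrees to isomorphism classes *)

Lemma zip_map2 (S T S' T' : Type) (f : S -> S') (g : T -> T') s t :
  zip (map f s) (map g t) = map (fun a => (f a.1, g a.2)) (zip s t).
Proof. by elim: s t => [|x s IHs] [|y t] //=; rewrite IHs. Qed.

Section Isomorphism.
Variables (V : finType) (k : nat).
Implicit Types (H : rooted_fat V k) (s t : {perm V}) (e : {set V}).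

Lemma is_isoP s H1 H2 :
  reflect (s (fat_root H1) = fat_root H2 /\ forall e, mult H2 (s @: e) = mult H1 e)
    (is_iso s H1 H2).
Proof.
apply: (iffP andP) => -[/eqP r m]; split=> //.
  by move=> e; apply/eqP; move/forallP: m; apply.
by apply/forallP=> e; apply/eqP.
Qed.

Lemma imset_permM s t e : (s * t)%g @: e = t @: (s @: e).
Proof. by rewrite -imset_comp; apply: eq_imset => x; rewrite permM. Qed.

Lemma imset_perm1 e : (1 : {perm V})%g @: e = e.
Proof. by rewrite -[RHS]imset_id; apply: eq_imset => x; rewrite perm1. Qed.

Lemma is_iso1 H : is_iso 1%g H H.
Proof. by apply/is_isoP; split=> [|e]; rewrite ?perm1 ?imset_perm1. Qed.

Lemma is_isoM s t H1 H2 H3 : is_iso s H1 H2 -> is_iso t H2 H3 ->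
  is_iso (s * t)%g H1 H3.
Proof.
move=> /is_isoP[r m] /is_isoP[r' m']; apply/is_isoP.
by split=> [|e]; rewrite ?permM ?r // imset_permM m' m.
Qed.

Lemma is_isoV s H1 H2 : is_iso s H1 H2 -> is_iso s^-1%g H2 H1.
Proof.
move=> /is_isoP[r m]; apply/is_isoP; split=> [|e]; first by rewrite -r permK.
by rewrite -m -imset_permM mulVg imset_perm1.
Qed.

Lemma is_iso_uniq s H H1 H2 : is_iso s H H1 -> is_iso s H H2 -> H1 = H2.
Proof.
case: H1 H2 => [m1 o1] [m2 o2] /is_isoP[r1 e1] /is_isoP[r2 e2].
congr (_, _); last by rewrite -[o1]r1 -[o2]r2.
apply/ffunP=> e; apply: val_inj; move: (e1 (s^-1%g @: e)) (e2 (s^-1%g @: e)).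
by rewrite /mult -imset_permM mulVg imset_perm1 /= => -> ->.
Qed.

Definition relabel s H : rooted_fat V k :=
  ([ffun e : {set V} => H.1 (s^-1%g @: e)], s H.2).

Lemma is_iso_relabel s H : is_iso s H (relabel s H).
Proof.
apply/is_isoP; split=> // e.
by rewrite /mult /= ffunE -imset_permM mulgV imset_perm1.
Qed.

Section Transport.
Variables (s : {perm V}) (H1 H2 : rooted_fat V k).
Hypothesis iso : is_iso s H1 H2.

Lemma iso_mult e : mult H2 (s @: e) = mult H1 e.
Proof. by case/is_isoP: iso. Qed.

Lemma iso_hyperedges e : (s @: e \in hyperedges H2) = (e \in hyperedges H1).
Proof. by rewrite !inE iso_mult. Qed.

Lemma iso_hyperedgesP (P : pred {set V}) :
  [forall e in hyperedges H2, P e] = [forall e in hyperedges H1, P (s @: e)].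
Proof.
apply/'forall_implyP/'forall_implyP=> P2 e eH; first by apply: P2; rewrite iso_hyperedges.
have <- : s @: (s^-1%g @: e) = e by rewrite -imset_permM mulVg imset_perm1.
apply: P2; rewrite -iso_hyperedges.
by rewrite -imset_permM mulVg imset_perm1.
Qed.

Lemma iso_is_tree : is_tree (@incidence V k H1) -> is_tree (@incidence V k H2).
Proof.
have fE e : e \in hyperedges H1 -> s @: e \in hyperedges H2 by rewrite iso_hyperedges.
have gE e : e \in hyperedges H2 -> s^-1%g @: e \in hyperedges H1.
  by rewrite -iso_hyperedges -imset_permM mulVg imset_perm1.
pose f (x : V + {e | e \in hyperedges H1}) : V + {e | e \in hyperedges H2} :=
  match x with inl v => inl (s v)
             | inr e => inr (exist _ (s @: val e) (fE _ (valP e))) end.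
pose g (x : V + {e | e \in hyperedges H2}) : V + {e | e \in hyperedges H1} :=
  match x with inl v => inl (s^-1%g v)
             | inr e => inr (exist _ (s^-1%g @: val e) (gE _ (valP e))) end.
apply: (@is_tree_transport _ _ _ _ f g).
- case=> [v|e] /=; first by rewrite permK.
  by congr inr; apply: val_inj; rewrite /= -imset_permM mulgV imset_perm1.
- case=> [v|e] /=; first by rewrite permKV.
  by congr inr; apply: val_inj; rewrite /= -imset_permM mulVg imset_perm1.
- by case=> [v|e] [v'|e'] //=; rewrite mem_imset //; apply: perm_inj.
Qed.

Lemma iso_fat_hypertrees p :
  H1 \in fat_hypertrees V k p -> H2 \in fat_hypertrees V k p.
Proof.
rewrite !inE => /and4P[/asboolP t1 c1 m1 s1]; apply/and4P; split.
- exact/asboolP/iso_is_tree.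
- rewrite iso_hyperedgesP; apply: etrans c1; apply: eq_forallb => e.
  by rewrite card_imset //; apply: perm_inj.
- rewrite iso_hyperedgesP; apply: etrans m1; apply: eq_forallb => e.
  by rewrite iso_mult.
- apply/eqP; rewrite -[RHS](eqP s1).
  rewrite (reindex_inj (imset_inj (@perm_inj _ s))) /=.
  by apply: eq_big => e; rewrite ?iso_hyperedges // iso_mult.
Qed.

Lemma iso_closed_walks w : w \in closed_walks H1 ->
  map_tuple s w \in closed_walks H2.
Proof.
rewrite !inE => /and3P[pw lw /'forall_implyP mw].
have r : fat_root H2 = s (fat_root H1) by case/is_isoP: iso.
rewrite r /=; apply/and3P; split.
- rewrite path_map; apply: sub_path pw => x y /=.
  case/clique_adjP=> nxy [e [eH xe ye]]; apply/clique_adjP.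
  split; first by rewrite (inj_eq perm_inj).
  by exists (s @: e); rewrite iso_hyperedges !mem_imset //; apply: perm_inj.
- by rewrite last_map (eqP lw).
- rewrite iso_hyperedgesP; apply/'forall_implyP=> e eH.
  rewrite iso_mult -(eqP (mw e eH)) /walk_mult /steps r /= -map_cons.
  rewrite zip_map2 count_map; apply/eqP/eq_count => xy /=.
  by rewrite !mem_imset //; apply: perm_inj.
Qed.

Lemma iso_leq_closed_walks : #|closed_walks H1| <= #|closed_walks H2|.
Proof.
rewrite -(card_imset (f := map_tuple s)).
  by apply/subset_leq_card/subsetP=> w /imsetP[w' /iso_closed_walks ? ->].
move=> w w' /(congr1 val) /= ww'; apply: val_inj.
exact: inj_map (@perm_inj _ s) _ _ ww'.
Qed.

End Transport.

Lemma iso_card_closed_walks s H1 H2 : is_iso s H1 H2 ->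
  #|closed_walks H1| = #|closed_walks H2|.
Proof.
move=> iso; apply/eqP; rewrite eqn_leq (iso_leq_closed_walks iso).
exact: iso_leq_closed_walks (is_isoV iso).
Qed.

(** The isomorphisms from [H1] to [H2] form a coset of the automorphism group of [H1]. *)
Lemma card_iso s H1 H2 : is_iso s H1 H2 ->
  #|[set t | is_iso t H1 H2]| = #|fat_aut H1|.
Proof.
move=> iso; rewrite -[RHS](card_imset _ (mulIg s)).
apply: eq_card => t; rewrite inE; apply/idP/imsetP.
  move=> it; exists (t * s^-1)%g; last by rewrite mulgVK.
  rewrite inE.
  exact: is_isoM it (is_isoV iso).
by case=> u; rewrite inE => iu ->; apply: is_isoM iu iso.
Qed.

Lemma isomorphicP H1 H2 : reflect (exists s, is_iso s H1 H2) (isomorphic H1 H2).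
Proof. exact: existsP. Qed.

Lemma isomorphic_equiv p :
  {in fat_hypertrees V k p & &, equivalence_rel (@isomorphic V k)}.
Proof.
move=> H1 H2 H3 _ _ _; split.
  by apply/isomorphicP; exists 1%g; apply: is_iso1.
move=> /isomorphicP[s i12]; apply/isomorphicP/isomorphicP => -[t i].
  by exists (s^-1 * t)%g; apply: is_isoM (is_isoV i12) i.
by exists (s * t)%g; apply: is_isoM i12 i.
Qed.

(* Orbit-stabilizer formula for the action of the permutations of [V]. *)
Lemma card_iso_class p H : H \in fat_hypertrees V k p ->
  (#|[set H' in fat_hypertrees V k p | isomorphic H H']| * #|fat_aut H| = #|V|`!)%N.
Proof.
move=> HD; rewrite -cardsT -card_perm.
have -> : #|perm_on [set: V]| = #|{: {perm V}}|.
  by apply: eq_card => s; rewrite !inE; apply/subsetP=> x; rewrite inE.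
rewrite -[RHS]sum1_card -sum_nat_const.
(* Double count of the pairs (s, H') with [s] carrying [H] to [H']: every permutation has exactly
   one image, [relabel s H]. *)
transitivity (\sum_(s : {perm V}) \sum_(H' in fat_hypertrees V k p | is_iso s H H') 1)%N.
  rewrite (exchange_big_dep (mem (fat_hypertrees V k p))) /=; last by move=> s H' _ /andP[].
  rewrite big_mkcond [RHS]big_mkcond /=; apply: eq_bigr => H' _; rewrite inE.
  case: ifP => [/andP[HD' /isomorphicP[s iso]]|nin].
    rewrite HD' -(card_iso iso) sum1dep_card.
    by apply: eq_card => t; rewrite !inE.
  case: ifP => // H'D; rewrite big1 // => s iso.
  by case/negP: (negbT nin); rewrite H'D; apply/isomorphicP; exists s; case/andP: iso.
apply: eq_bigr => s _; rewrite (big_pred1 (relabel s H)) // => H' /=.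
apply/andP/eqP => [[_ iso]|->]; first exact: is_iso_uniq iso (is_iso_relabel s H).
by split; [exact: (iso_fat_hypertrees (is_iso_relabel s H)) | exact: is_iso_relabel].
Qed.

End Isomorphism.

Local Open Scope ring_scope.

(** * Evaluation of [eta] when only multiplicity 2 carries weight *)

Section Eta.
Variables (R : realFieldType) (q : nat) (a : nat -> R).
Hypotheses (a2 : a 2 = q`!%:R) (a3 : forall r, (2 < r)%N -> a r = 0).

(** A class contains n! / |Aut| labelled hypertrees, so dividing by |Aut| on representatives amounts
    to dividing by n! on all labelled ones. *)
Lemma sum_iso_classes k n (f : rooted_fat 'I_n k -> R) p :
  (forall s H1 H2, H1 \in fat_hypertrees 'I_n k p -> is_iso s H1 H2 -> f H1 = f H2) ->
  \sum_(H in fat_hypertree_classes p k n) #|fat_aut H|%:R^-1 * f H =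
  n`!%:R^-1 * \sum_(H in fat_hypertrees 'I_n k p) f H.
Proof.
move=> fiso; rewrite /fat_hypertree_classes.
set D := fat_hypertrees _ _ _; set P := equivalence_partition _ _.
have eqv := @isomorphic_equiv 'I_n k p.
have partP : partition P D by apply: equivalence_partitionP.
have trX := transversalP partP; set X := transversal P D in trX *.
(* [H0] serves as the default value of [transversal_repr], hence the separate case of an empty
   [D]. *)
have [H0 _|D0] := pickP (mem D); last first.
  rewrite !big1 ?mulr0 // => H.
    by have := D0 H; rewrite /= => ->.
  by move=> /(subsetP (transversal_sub trX)); have := D0 H; rewrite /= => ->.
pose r H := transversal_repr H0 X (pblock P H).
have PD H : H \in D -> pblock P H \in P.
  by move=> HD; rewrite pblock_mem // (cover_partition partP).
rewrite [\sum_(H in D) _](partition_big r (mem X)) /=; last first.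
  by move=> H HD; apply: (repr_mem_transversal trX H0 (PD H HD)).
rewrite mulr_sumr; apply: eq_bigr => H HX.
have HD := subsetP (transversal_sub trX) H HX.
have rE H' : H' \in D -> (r H' == H) = isomorphic H H'.
  move=> HD'; rewrite -(pblock_equivalence_partition eqv) //.
  have tP := partition_trivIset partP.
  apply/eqP/idP => [<-|].
    by rewrite /r (transversal_reprK trX) ?PD // mem_pblock (cover_partition partP).
  by move=> /(same_pblock tP) e; rewrite /r e (pblockK trX).
rewrite (eq_bigr (fun=> f H)); last first.
  move=> H' /andP[HD']; rewrite rE // => /isomorphicP[s iso].
  exact/esym/(fiso s).
rewrite sumr_const -[f H *+ _]mulr_natl mulrA; congr (_ * _).
have := card_iso_class HD; rewrite card_ord -/D => cE.
have -> : #|[pred H' in D | r H' == H]| = #|[set H' in D | isomorphic H H']|.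
  by apply: eq_card => H'; rewrite [LHS]inE [RHS]inE; case H'D: (H' \in D) => //=; rewrite -rE.
apply/eqP; rewrite -cE natrM invfM mulrAC.
have c0 : (#|[set H' in D | isomorphic H H']|%:R : R) != 0.
  have n0 := fact_gt0 n; rewrite -cE muln_gt0 in n0.
  by rewrite pnatr_eq0 -lt0n; case/andP: n0.
by rewrite mulVf // mul1r.
Qed.

Definition all_twice n k (H : rooted_fat 'I_n k) : bool :=
  [forall e in hyperedges H, mult H e == 2].

(** One multiplicity above 2 makes the product vanish; otherwise there are k/2 hyperedges, each with
    weight q!. *)
Lemma sum_walks n k (H : rooted_fat 'I_n k) : H \in fat_hypertrees 'I_n k q.+2 ->
  \sum_(w in closed_walks H) \prod_(e in hyperedges H) a (walk_mult H w e) =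
  q`!%:R ^+ k./2 * (all_twice H * #|closed_walks H|)%N%:R.
Proof.
rewrite inE => /and4P[_ _ /'forall_implyP m2 /eqP mk].
rewrite (eq_bigr (fun=> \prod_(e in hyperedges H) a (mult H e))); last first.
  move=> w; rewrite inE => /and3P[_ _ /'forall_implyP mw].
  by apply: eq_bigr => e eH; rewrite (eqP (mw e eH)).
rewrite sumr_const; case: (boolP (all_twice H)) => [/'forall_implyP t|].
  rewrite mul1n -[LHS]mulr_natr; congr (_ * _).
  rewrite (eq_bigr (fun=> q`!%:R)); last by move=> e eH; rewrite (eqP (t e eH)).
  rewrite prodr_const; congr (_ ^+ _).
  rewrite -[in RHS]mk (eq_bigr (fun=> 2)); last by move=> e /t /eqP.
  by rewrite sum_nat_const muln2 doubleK.
rewrite negb_forall => /existsP[e]; rewrite negb_imply => /andP[eH ne].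
rewrite mul0n mulr0 (bigD1 e) //= a3 ?mul0r ?mul0rn //.
by have := m2 e eH; rewrite leq_eqVlt eq_sym (negPf ne).
Qed.

Lemma iso_all_twice n k (s : {perm 'I_n}) (H1 H2 : rooted_fat 'I_n k) :
  is_iso s H1 H2 -> all_twice H2 = all_twice H1.
Proof.
move=> iso; rewrite /all_twice (iso_hyperedgesP iso).
by apply: eq_forallb => e; rewrite (iso_mult iso).
Qed.

Lemma sum_fat_weight k n :
  \sum_(H in fat_hypertree_classes q.+2 k n) fat_weight a H =
  n`!%:R^-1 * (q`!%:R ^+ k./2 * (n * run_count q k 0 n.-1)%N%:R).
Proof.
pose f (H : rooted_fat 'I_n k) : R :=
  q`!%:R ^+ k./2 * (all_twice H * #|closed_walks H|)%N%:R.
have sub : fat_hypertree_classes q.+2 k n \subset fat_hypertrees 'I_n k q.+2.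
  by apply: transversal_sub; apply: transversalP; apply: equivalence_partitionP;
     apply: isomorphic_equiv.
rewrite (eq_bigr (fun H => #|fat_aut H|%:R^-1 * f H)); last first.
  by move=> H /(subsetP sub) HD; rewrite /fat_weight sum_walks.
rewrite sum_iso_classes; last first.
  move=> s H1 H2 _ iso.
  by rewrite /f (iso_all_twice iso) (iso_card_closed_walks iso).
rewrite -mulr_sumr -natr_sum; congr (_ * (_ * _%:R)).
have := card_twice_crossed 'I_n q k; rewrite card_ord => <-.
pose F (H : rooted_fat 'I_n k) (w : k.-tuple 'I_n) : nat :=
  [&& H \in fat_hypertrees 'I_n k q.+2, w \in closed_walks H & all_twice H].
have -> : #|twice_crossed 'I_n q k| = (\sum_H \sum_w F H w)%N.
  rewrite pair_bigA -sum1_card big_mkcond; apply: eq_bigr => -[H w] _.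
  by rewrite inE /F; case: ifP.
rewrite /F big_mkcond; apply: eq_bigr => H _; case: ifP => HD /=; last by rewrite big1.
rewrite -sum1_card; case: (all_twice H); last first.
  by rewrite mul0n big1 // => w _; rewrite andbF.
by rewrite mul1n big_mkcond; apply: eq_bigr => w _; rewrite andbT.
Qed.

(** A hypertree with k/2 hyperedges of size [q.+2] has (k/2)(q+1)+1 vertices, so at most one value
    of [n] contributes. There the [n] roots and the (n-1)! of [run_countE] cancel n!, and the powers
    of q! cancel each other. *)
Lemma eta_ballot k : eta q.+2 a k = if odd k then 0 else (ballot k 0)%:R.
Proof.
case: k => [|k] //; rewrite /eta; move: k.+1 => {}k.
under eq_bigr do rewrite sum_fat_weight.
have term n : n`!%:R^-1 * (q`!%:R ^+ k./2 * (n * run_count q k 0 n.-1)%N%:R) =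
  if ~~ odd k && (n == (k./2 * q.+1).+1) then (ballot k 0)%:R else 0 :> R.
  case: n => [|n]; first by rewrite mul0n !mulr0 andbF.
  rewrite eqSS /=; case: ifP => [/andP[ek /eqP->]|].
    have kE : k = (0 + k./2.*2)%N by rewrite add0n -[LHS]odd_double_half (negPf ek).
    have := run_countE q kE; move: (k./2 * q.+1)%N => u cE.
    have u0 : (u.+1`!%:R : R) != 0 by rewrite pnatr_eq0 -lt0n fact_gt0.
    apply: (mulfI u0); rewrite mulVKf // -natrX -!natrM; congr _%:R.
    by rewrite factS mulnCA -mulnA; congr muln; rewrite mulnC cE mulnC.
  move=> /negP c; suff -> : run_count q k 0 n = 0%N by rewrite muln0 !mulr0.
  apply/eqP; apply/negPn/negP => /run_count_neq0[j kE nE]; case: c.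
  by rewrite kE nE add0n odd_double doubleK eqxx.
rewrite (eq_bigr (fun n : 'I_((k * q.+1).+2) => if ~~ odd k && (val n == (k./2 * q.+1).+1)
  then (ballot k 0)%:R else 0)); last by move=> n _; apply: term.
case: (odd k) => /=; first by rewrite big1.
have lt : ((k./2 * q.+1).+1 < (k * q.+1).+2)%N.
  by rewrite !ltnS leq_mul2r orbC -leq_double -{2}(odd_double_half k) -addnn; lia.
rewrite (bigD1 (Ordinal lt)) //= eqxx big1 ?addr0 // => i.
by rewrite -val_eqE /= => /negPf ->.
Qed.

End Eta.

From mathcomp Require Import all_classical all_reals all_analysis.
From mathcomp Require Import measurable_realfun lra.
Import numFieldNormedType.Exports.

Local Open Scope classical_set_scope.
Local Open Scope ring_scope.

(** * The semicircle law *)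

Section SemicircleMoments.
Context {R : realType}.
Local Notation mu := (@lebesgue_measure R).
Implicit Type x : R.

Definition half_circle x : R := Num.sqrt (4 - x ^+ 2).

Lemma continuous_half_circle : continuous half_circle.
Proof.
move=> x; apply: (@continuous_comp _ _ _ (fun x => 4 - x ^+ 2) Num.sqrt).
  by apply: cvgB; [exact: cvg_cst | exact: exprn_continuous].
exact: sqrt_continuous.
Qed.

Lemma in_disc x : x \in `]-2, 2[ -> 0 < 4 - x ^+ 2.
Proof. rewrite in_itv /= => /andP[? ?]; nra. Qed.

Lemma is_derive_half_circle x : x \in `]-2, 2[ ->
  is_derive x 1 half_circle (- x / half_circle x).
Proof.
move=> xI; have x0 := in_disc xI.
have d1 : is_derive x 1 (fun x : R => 4 - x ^+ 2) (- (x *+ 2)).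
  by apply: is_derive_eq; rewrite ?sub0r ?expr1 ?scaler1 /GRing.scale /=; ring.
have d2 := is_derive1_sqrt x0.
have /is_derive_eq := @is_derive1_comp _ Num.sqrt (fun x : R => 4 - x ^+ 2) x _ _ d2 d1.
apply; rewrite /half_circle /GRing.scale /=.
have : Num.sqrt (4 - x ^+ 2) != 0 by rewrite gt_eqF // sqrtr_gt0.
by move=> w0; field; rewrite w0.
Qed.

Lemma half_circle_sqr x : x \in `]-2, 2[ -> half_circle x ^+ 2 = 4 - x ^+ 2.
Proof. by move=> /in_disc x0; rewrite sqr_sqrtr // ltW. Qed.

Lemma half_circle_gt0 x : x \in `]-2, 2[ -> 0 < half_circle x.
Proof. by move=> /in_disc x0; rewrite sqrtr_gt0. Qed.

Lemma half_circle2 : half_circle 2 = 0.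
Proof. by rewrite /half_circle [X in Num.sqrt X](_ : _ = 0) ?sqrtr0 //; ring. Qed.

Lemma half_circleN2 : half_circle (- 2) = 0.
Proof. by rewrite /half_circle [X in Num.sqrt X](_ : _ = 0) ?sqrtr0 //; ring. Qed.

(** [half_circle] is not differentiable at the endpoints, so the primitive is only asked to be
    continuous on the segment and differentiable inside. *)
Lemma integral_derive (f F : R -> R) : continuous f -> {within `[-2, 2], continuous F} ->
  (forall x, x \in `]-2, 2[ -> is_derive x 1 F (f x)) ->
  (\int[mu]_(x in `[-2, 2]) f x = F 2 - F (- 2))%R.
Proof.
move=> cf cF dF; rewrite /Rintegral.
have lt22 : (-2 < 2 :> R) by lra.
rewrite (@continuous_FTC2 _ f F) //.
- exact: continuous_subspaceT.
- have [_ cl cr] := (continuous_within_itvP F lt22).1 cF.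
  by split=> // x xI; have [] := dF x xI.
- by move=> x xI; have dFx := dF x xI; rewrite derive1E derive_val.
Qed.

Definition moment k : R := \int[mu]_(x in `[-2, 2]) (x ^+ k * half_circle x).

Lemma continuous_moment k : continuous (fun x => x ^+ k * half_circle x).
Proof.
move=> x; apply: cvgM; first exact: exprn_continuous.
exact: continuous_half_circle.
Qed.

Lemma integrable_moment k :
  mu.-integrable `[-2, 2] (EFin \o (fun x => x ^+ k * half_circle x)).
Proof.
apply: continuous_compact_integrable; first exact: segment_compact.
by apply: continuous_subspaceT => x; apply: continuous_moment.
Qed.

Lemma moment1 : moment 1 = 0.
Proof.
(* This is -(4 - x^2)^(3/2) / 3. The moment recursion has step 2, so the odd moments need a base
   case of their own. *)
pose F x := - ((4 - x ^+ 2) * half_circle x) / 3.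
have cF : continuous F.
  move=> x; apply: cvgM; last exact: cvg_cst.
  apply: cvgN; apply: cvgM; last exact: continuous_half_circle.
  by apply: cvgB; [exact: cvg_cst | exact: exprn_continuous].
have -> : moment 1 = F 2 - F (- 2).
  apply: integral_derive.
  - exact: continuous_moment.
  - exact: continuous_subspaceT.
  move=> x xI; have dw := is_derive_half_circle xI.
  apply: is_derive_eq; have := half_circle_gt0 xI; have := half_circle_sqr xI.
  rewrite /GRing.scale /=; move: (half_circle x) => w w2 w0.
  by rewrite -w2; field; rewrite gt_eqF.
by rewrite /F half_circle2 half_circleN2 !mulr0 oppr0 mul0r subr0.
Qed.

Lemma moment_rec k : (k.+4)%:R * moment k.+2 = 4 * k.+1%:R * moment k.
Proof.
pose F x := x ^+ k.+1 * ((4 - x ^+ 2) * half_circle x).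
have cF : continuous F.
  move=> x; apply: cvgM; first exact: exprn_continuous.
  apply: cvgM; last exact: continuous_half_circle.
  by apply: cvgB; [exact: cvg_cst | exact: exprn_continuous].
(* With w = [half_circle x], [F] is x^(k+1) w^3. Its derivative (k+1) x^k w^3 - 3 x^(k+2) w becomes
   [f] on replacing w^2 by 4 - x^2, and [F] vanishes at both ends. *)
pose f x := 4 * k.+1%:R * (x ^+ k * half_circle x) - k.+4%:R * (x ^+ k.+2 * half_circle x).
have fF : \int[mu]_(x in `[-2, 2]) f x = F 2 - F (- 2).
  apply: integral_derive.
  - move=> x; apply: cvgB; (apply: cvgM; [exact: cvg_cst | exact: continuous_moment]).
  - exact: continuous_subspaceT.
  move=> x xI; have dw := is_derive_half_circle xI.
  have dk : is_derive x 1 (fun x : R => x ^+ k.+1) (k.+1%:R * x ^+ k).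
    have := is_deriveX k.+1 (is_derive_id x (1 : R)).
    by rewrite exprfctE /GRing.scale /= mulr1.
  rewrite /F; apply: is_derive_eq.
  have := half_circle_gt0 xI; have := half_circle_sqr xI.
  rewrite /f /GRing.scale /=; move: (half_circle x) => w w2 w0.
  have -> : (4 - x ^+ 2) * (- x / w) = - x * w.
    by rewrite -w2; field; rewrite gt_eqF.
  by rewrite !exprS; ring.
move: fF; rewrite {1}/f RintegralB //=; last 2 first.
- exact: (integrableZl _ _ (integrable_moment k)).
- exact: (integrableZl _ _ (integrable_moment k.+2)).
rewrite !RintegralZl //; last 2 first.
- exact: integrable_moment.
- exact: integrable_moment.
rewrite /F half_circle2 half_circleN2 !mulr0 subr0 => /eqP.
by rewrite subr_eq0 => /eqP ->.
Qed.

(** The endpoints are included, although [asin] has no derivative there: the function is the inverse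
    of the continuous 2 sin on [-pi/2, pi/2]. *)
Lemma continuous_asin_half : {within `[-2, 2], continuous (fun x => asin (x / 2))}.
Proof.
have pi0 := @pi_gt0 R.
have := @segment_can_le_continuous R (- (pi / 2)) (pi / 2) (fun x => 2 * sin x)
  (fun x => asin (x / 2)).
rewrite sinN sin_pihalf mulrN !mulr1; apply; first by lra.
  apply: continuous_subspaceT => x; apply: cvgM; first exact: cvg_cst.
  exact: continuous_sin.
by move=> x xI; rewrite mulrAC divff // mul1r sinK.
Qed.

Lemma moment0 : moment 0 = 2 * pi.
Proof.
have pi0 := @pi_gt0 R.
pose F x := x * half_circle x / 2 + 2 * asin (x / 2).
have asin1 : asin 1 = pi / 2 :> R.
  by rewrite -[X in asin X]sin_pihalf sinK // in_itv /=; apply/andP; split; lra.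
have asinN1 : asin (- 1) = - (pi / 2) :> R.
  by rewrite -[X in asin (- X)]sin_pihalf -sinN sinK // in_itv /=; apply/andP; split; lra.
have -> : moment 0 = F 2 - F (- 2).
  apply: integral_derive.
  - exact: continuous_moment.
  - move=> x; apply: cvgD; last first.
      by apply: cvgM; [exact: cvg_cst | exact: continuous_asin_half].
    have cw : continuous (fun x => x * half_circle x / 2).
      move=> y; apply: cvgM; last exact: cvg_cst.
      by apply: cvgM; [exact: cvg_id | exact: continuous_half_circle].
    exact: (continuous_subspaceT cw).
  move=> x xI; have dw := is_derive_half_circle xI.
  have x1 : -1 < x / 2 < 1.
    by move: xI; rewrite in_itv /= => /andP[? ?]; apply/andP; split; lra.
  have da := is_derive1_asin x1.
  have dh : is_derive x 1 (fun x : R => x / 2) 2^-1.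
    by apply: is_derive_eq; rewrite /GRing.scale /=; ring.
  have dc := @is_derive1_comp _ (@asin R) (fun x : R => x / 2) x _ _ da dh.
  have dm : is_derive x 1 (fun x : R => 2 * asin (x / 2))
     (2 * ((Num.sqrt (1 - (x / 2) ^+ 2))^-1 * 2^-1)).
    by apply: is_derive_eq; rewrite /GRing.scale /=; ring.
  apply: is_derive_eq; have := half_circle_gt0 xI; have := half_circle_sqr xI.
  rewrite /GRing.scale /=; move: (half_circle x) => w w2 w0.
  have wn0 : w != 0 by rewrite gt_eqF.
  have -> : 1 - (x / 2) ^+ 2 = (w / 2) ^+ 2 by rewrite [RHS]exprMn w2; field.
  rewrite sqrtr_sqr ger0_norm; last by lra.
  have -> : x * (- x / w) = (w ^+ 2 - 4) / w by rewrite w2; field.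
  by field.
rewrite /F half_circle2 half_circleN2 !mulr0 !mul0r !add0r mulNr divff // asin1 asinN1.
by field.
Qed.

End SemicircleMoments.

(** * Polynomial approximation of a step function *)

Section Step.
Context {R : realType}.
Implicit Types x y t : R.

Lemma bernoulli_ge t m : 0 <= t <= 1 -> 1 - m%:R * t <= (1 - t) ^+ m.
Proof.
move=> /andP[t0 t1]; elim: m => [|m IHm]; first by rewrite mul0r subr0 expr0.
rewrite exprS; apply: (@le_trans _ _ ((1 - t) * (1 - m%:R * t))).
  by have m0 := ler0n R m; rewrite -natr1; nra.
by rewrite ler_wpM2l // subr_ge0.
Qed.

(** Bernoulli's inequality for 1 + t, combined with (1 - t)^m (1 + t)^m = (1 - t^2)^m <= 1. *)
Lemma bernoulli_le t m : 0 <= t <= 1 -> (1 - t) ^+ m * (1 + m%:R * t) <= 1.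
Proof.
move=> /andP[t0 t1]; have b : 1 + m%:R * t <= (1 + t) ^+ m.
  elim: m => [|m IHm]; first by rewrite mul0r addr0 expr0.
  rewrite exprS; apply: (@le_trans _ _ ((1 + t) * (1 + m%:R * t))).
    by have m0 := ler0n R m; rewrite -natr1; nra.
  by rewrite ler_wpM2l // addr_ge0.
apply: (@le_trans _ _ ((1 - t) ^+ m * (1 + t) ^+ m)).
  by rewrite ler_wpM2l // exprn_ge0 // subr_ge0.
by rewrite -exprMn exprn_ile1 //; nra.
Qed.

(* These polynomials converge to the indicator of [y < 1/2] on [0, 1]. *)
Definition step n y : R := (1 - y ^+ n) ^+ (n * 2 ^ n).

Lemma step_bounds n y : 0 <= y <= 1 -> 0 <= step n y <= 1.
Proof.
move=> /andP[y0 y1]; have := exprn_ge0 n y0; have := exprn_ile1 n y0 y1.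
by move=> a b; apply/andP; split; [apply: exprn_ge0 | apply: exprn_ile1]; lra.
Qed.

(** With s = sqrt z, [bernoulli_le] at t = 1 - s gives n (1 - s) s^n <= 1, and one more factor s^n
    gives n z^n <= s^n / (1 - s). *)
Lemma cvg_mulrn_expr z : 0 <= z < 1 -> n%:R * z ^+ n @[n --> \oo] --> (0 : R).
Proof.
move=> /andP[z0 z1].
pose s := Num.sqrt z; have s0 : 0 <= s by apply: sqrtr_ge0.
have s1 : s < 1 by rewrite -sqrtr1 ltr_sqrt.
have zE : z = s ^+ 2 by rewrite sqr_sqrtr.
have bound n : n%:R * z ^+ n <= s ^+ n / (1 - s).
  have s01 : 0 <= 1 - s <= 1 by rewrite subr_ge0 (ltW s1) lerBlDr lerDl.
  have := bernoulli_le n s01; rewrite opprB addrC subrK.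
  have sn0 := exprn_ge0 n s0; have t0 : 0 < 1 - s by rewrite subr_gt0.
  rewrite ler_pdivlMr // zE -exprM mulnC exprM expr2.
  move: (s ^+ n) sn0 => u u0; move: (1 - s) t0 => t t0; move: (n%:R) => m h.
  have mtu : m * t * u <= 1 by nra.
  rewrite (_ : _ * t = m * t * u * u); last by ring.
  by rewrite -[X in _ <= X]mul1r ler_wpM2r.
have cs : s ^+ n / (1 - s) @[n --> \oo] --> 0.
  rewrite -[X in _ --> X](mul0r (1 - s)^-1); apply: cvgMl.
  by apply: cvg_expr; rewrite ger0_norm.
apply: (squeeze_cvgr _ (cvg_cst 0) cs).
by apply: nearW => n; rewrite mulr_ge0 ?exprn_ge0 ?ler0n //=.
Qed.

(** The exponent is chosen so that n 2^n y^n = n (2y)^n, which tends to 0 for y < 1/2 and is at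
    least n for y >= 1/2. The Bernoulli bounds then squeeze [step n y] to 1, respectively below
    1/(n+1). The limit 0 at y = 1/2 itself matches open half-lines. *)
Lemma cvg_step y : 0 <= y <= 1 ->
  step n y @[n --> \oo] --> (if y < 2^-1 then 1 else 0 : R).
Proof.
move=> y01; have /andP[y0 y1] := y01.
have yn01 n : 0 <= y ^+ n <= 1 by rewrite exprn_ge0 // exprn_ile1.
have mE n : (n * 2 ^ n)%:R * y ^+ n = n%:R * (2 * y) ^+ n.
  by rewrite natrM natrX exprMn mulrA.
case: ifPn => [ylt|]; last rewrite -leNgt => yge.
  have c0 : n%:R * (2 * y) ^+ n @[n --> \oo] --> (0 : R).
    by apply: cvg_mulrn_expr; apply/andP; split; lra.
  have c1 : 1 - n%:R * (2 * y) ^+ n @[n --> \oo] --> (1 : R).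
    by rewrite -[X in _ --> X]subr0; apply: cvgB c0; exact: cvg_cst.
  apply: (squeeze_cvgr _ c1 (cvg_cst (1 : R))); apply: nearW => n.
  rewrite -mE bernoulli_ge //=.
  by case/andP: (step_bounds n y01).
have c0 : harmonic n @[n --> \oo] --> (0 : R) by exact: cvg_harmonic.
apply: (squeeze_cvgr _ (cvg_cst 0) c0); apply: nearW => n.
have /andP[s0 _] := step_bounds n y01; rewrite s0 /=.
have := bernoulli_le (n * 2 ^ n) (yn01 n); rewrite -/(step n y) mE => h.
rewrite -[X in _ <= X]mul1r ler_pdivlMr ?ltr0n //; apply: le_trans h.
rewrite ler_wpM2l // -natr1 addrC lerD2l -[X in X <= _]mulr1 ler_wpM2l //.
by apply: exprn_ege1; lra.
Qed.

End Step.

(** * The semicircle law as a measure *)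

Section SemicircleMeasure.
Context {R : realType}.
Local Notation mu := (@lebesgue_measure R).

Lemma semicircle_densityE :
  (fun x : R => (semicircle_density x)%:E) =
  (fun x => (half_circle x / (2 * pi))%:E) \_ `[-2, 2].
Proof.
apply/funext=> x; rewrite patchE /semicircle_density /half_circle.
rewrite mem_setE in_itv /= ler_norml.
by case: ifP.
Qed.

Lemma semicircle_density_ge0 (x : R) : 0 <= semicircle_density x.
Proof.
rewrite /semicircle_density; case: ifP => // _.
by rewrite divr_ge0 ?sqrtr_ge0 // mulr_ge0 // pi_ge0.
Qed.

Lemma integrable_half_circle :
  mu.-integrable `[-2, 2] (fun x : R => (half_circle x / (2 * pi))%:E).
Proof.
apply: continuous_compact_integrable; first exact: segment_compact.
apply: continuous_subspaceT => x; apply: cvgM; last exact: cvg_cst.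
exact: continuous_half_circle.
Qed.

Lemma integrable_semicircle_density :
  mu.-integrable setT (fun x : R => (semicircle_density x)%:E).
Proof.
rewrite semicircle_densityE; apply/(integrable_mkcond _ _).1 => //.
exact: integrable_half_circle.
Qed.

(** [semicircle_law] is defined as a bare set function; uniqueness of measures on generators
    requires the measure structure built here. *)
Let sc0 : @semicircle_law R set0 = 0%E.
Proof. exact: integral_set0. Qed.

Let sc_ge0 A : (0 <= @semicircle_law R A)%E.
Proof. by apply: integral_ge0 => x _; rewrite lee_fin semicircle_density_ge0. Qed.

Let sc_sigma_additive : semi_sigma_additive (@semicircle_law R).
Proof.
move=> /= A mA tA mUA.
rewrite /semicircle_law /= integral_bigcup //=; last first.
  by apply: (integrableS _ _ (subsetT _)) => //; exact: integrable_semicircle_density.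
apply: is_cvg_ereal_nneg_natsum_cond => n _ _.
by apply: integral_ge0 => /= x ?; rewrite lee_fin semicircle_density_ge0.
Qed.

HB.instance Definition _ := isMeasure.Build _ _ _
  (@semicircle_law R) sc0 sc_ge0 sc_sigma_additive.

Lemma semicircle_law_itv (a : R) : semicircle_law `]-oo, a[ =
  (\int[mu]_(x in `[(-2)%R, 2%R])
     ((if x < a then 1 else 0) * (half_circle x / (2 * pi)))%:E)%E.
Proof.
rewrite /semicircle_law integral_mkcond [RHS]integral_mkcond; congr integral.
rewrite semicircle_densityE; apply/funext=> x; rewrite !patchE !mem_setE !in_itv /=.
by do 2![case: ifP => _]; rewrite ?mul1r ?mul0r.
Qed.

(* Half-lines generate the Borel sets. *)
Lemma eq_semicircle_law (nu : probability (measurableTypeR R) R) :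
  (forall a : R, nu `]-oo, a[%classic = semicircle_law `]-oo, a[%classic) ->
  forall A, measurable A -> nu A = semicircle_law A.
Proof.
move=> eq_itv A mA.
pose g k : set (measurableTypeR R) := `]-oo, (k%:R : R)[%classic.
apply: (@g_sigma_algebra_measure_unique _ R (measurableTypeR R) (@RGenInftyO.G R)
  _ g _ _ nu (@semicircle_law R)).
- by move=> _ [x ->]; apply: measurable_itv.
- by move=> i; exists i%:R.
- apply/seteqP; split=> // x _; exists (Num.bound `|x|) => //=.
  by rewrite /g /= in_itv /=; apply: le_lt_trans (ler_norm x) (archi_boundP (normr_ge0 x)).
- move=> _ _ [x ->] [y ->]; exists (Num.min x y).
  by apply/seteqP; split=> z /=; rewrite !in_itv /= lt_min => /andP.
- by move=> _ [x ->]; apply: eq_itv.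
- move=> k; apply: (@le_lt_trans _ _ 1%E); rewrite ?ltry // probability_le1 //.
  exact: measurable_itv.
- exact: (eq_ind _ (fun B => B A) mA _ (RGenInftyO.measurableE R)).
Qed.

End SemicircleMeasure.

(** * Determinacy of the semicircle law by its moments *)

Section Determinacy.
Context {R : realType}.
Local Notation mu := (@lebesgue_measure R).
Local Notation D := (`[(-2)%R, 2%R]%classic : set R).
Variable nu : probability (measurableTypeR R) R.
Hypothesis nu_moments : forall k,
  (\int[nu]_x (x ^+ k)%:E)%E = (moment k / (2 * pi))%:E.

Lemma measurable_expr k : measurable_fun [set: measurableTypeR R] (fun x : R => x ^+ k).
Proof. exact: exprn_measurable. Qed.

Lemma moment_even_ge0 l : 0 <= @moment R l.*2.
Proof.
by apply: Rintegral_ge0 => x _; rewrite mulr_ge0 ?sqrtr_ge0 // -mul2n exprM exprn_ge0 ?sqr_ge0.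
Qed.

Lemma moment_le l : @moment R l.*2 <= 2 * pi * 4 ^+ l.
Proof.
elim: l => [|l IHl]; first by rewrite moment0 expr0 mulr1.
have := moment_rec (R := R) l.*2; have m0 := moment_even_ge0 l.
rewrite doubleS exprS; have l0 := ler0n R l.*2.
have -> : l.*2.+4%:R = l.*2%:R + 4 :> R by rewrite -addn4 natrD.
have -> : l.*2.+1%:R = l.*2%:R + 1 :> R by rewrite -addn1 natrD.
move: IHl m0; move: (moment l.*2.+2) (moment l.*2) => m' m.
move: (l.*2%:R) l0 (4 ^+ l) => t t0 u IHl m0 h.
have t4 : 0 < t + 4 by lra.
have : m' <= 4 * m by rewrite -(ler_pM2l t4) h; nra.
by move: IHl; lra.
Qed.

(** For odd [k] the value of the integral does not by itself give integrability; |x^k| <= 1 + x^(2k)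
    reduces it to an even moment, whose integrand is nonnegative. *)
Lemma integrable_expr k : nu.-integrable setT (fun x : R => (x ^+ k)%:E).
Proof.
have even0 (x : R) : 0 <= x ^+ k.*2 by rewrite -mul2n exprM exprn_ge0 ?sqr_ge0.
apply/integrableP; split; first by apply/measurable_EFinP; exact: measurable_expr.
apply: (@le_lt_trans _ _ (\int[nu]_x (1 + (x ^+ k.*2)%:E))%E).
  apply: ge0_le_integral => //.
  - by apply: measurableT_comp => //; apply/measurable_EFinP; exact: measurable_expr.
  - apply/measurable_EFinP; apply: measurable_funD => //; exact: measurable_expr.
  - move=> x _; rewrite -EFinD abse_EFin lee_fin -muln2 exprM.
    by move: (x ^+ k) => t; rewrite ler_norml; apply/andP; split; nra.
rewrite ge0_integralD //; last 2 first.
- by move=> x _; rewrite lee_fin even0.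
- by apply/measurable_EFinP; exact: measurable_expr.
rewrite integral_cst // [X in (1 * X)%E](_ : _ = 1%E); last exact: probability_setT.
by rewrite mule1 nu_moments -EFinD ltry.
Qed.

Lemma measurable_disc : measurable (D : set (measurableTypeR R)).
Proof. exact: measurable_itv. Qed.

(** Markov's inequality for x^(2l) gives nu B <= (4 / c^2)^l for every l, and 4 / c^2 < 1. *)
Lemma nu_tail (c : R) (B : set (measurableTypeR R)) : 2 < c -> measurable B ->
  (forall x, B x -> c ^+ 2 <= x ^+ 2) -> nu B = 0%E.
Proof.
move=> c2 mB Bc.
have : nu B \is a fin_num by apply: fin_num_measure.
move nuB : (nu B) => b; case: b nuB => // b nuB _.
have b0 : 0 <= b by rewrite -lee_fin -nuB.
have pi0 := @pi_gt0 R.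
have bound l : b <= (4 / c ^+ 2) ^+ l.
  have cl0 : 0 < (c ^+ 2) ^+ l by rewrite !exprn_gt0 //; lra.
  rewrite exprMn exprVn ler_pdivlMr // mulrC -lee_fin EFinM -nuB.
  apply: (@le_trans _ _ (\int[nu]_(x in B) (x ^+ l.*2)%:E)%E).
    rewrite -integral_cst //; apply: ge0_le_integral => //.
    - by move=> x _; rewrite lee_fin ltW.
    - apply/measurable_EFinP; apply: measurable_funS (measurable_expr _) => //.
    - move=> x Bx; rewrite lee_fin -mul2n exprM lerXn2r ?nnegrE ?sqr_ge0 //.
      exact: Bc.
  apply: (@le_trans _ _ (\int[nu]_x (x ^+ l.*2)%:E)%E).
    apply: ge0_subset_integral => //.
    - by apply/measurable_EFinP; exact: measurable_expr.
    - by move=> x _; rewrite lee_fin -mul2n exprM exprn_ge0 ?sqr_ge0.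
  rewrite nu_moments lee_fin ler_pdivrMr ?mulr_gt0 // mulrC.
  exact: moment_le.
have z1 : 4 / c ^+ 2 < 1 by rewrite ltr_pdivrMr ?mul1r; nra.
have cz : (4 / c ^+ 2) ^+ l @[l --> \oo] --> (0 : R).
  by apply: cvg_expr; rewrite ger0_norm // divr_ge0 // sqr_ge0.
have b1 : b <= 0 by apply: (ler_cvg_to (cvg_cst b) cz); exact: nearW.
by congr EFin; apply/eqP; rewrite eq_le b1.
Qed.

Lemma nu_supp : nu (~` D) = 0%E.
Proof.
pose B n := `]-oo, (- (2 + n.+1%:R^-1))%R] `|` `[(2 + n.+1%:R^-1)%R, +oo[
  : set (measurableTypeR R).
have mB n : measurable (B n) by apply: measurableU; apply: measurable_itv.
have B0 n : nu (B n) = 0%E.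
  have n0 : 0 < n.+1%:R^-1 :> R by rewrite invr_gt0 ltr0n.
  apply: (@nu_tail (2 + n.+1%:R^-1)) => //; first by rewrite ltrDl.
  move=> x [] /=; rewrite in_itv /= ?andbT.
    move: (n.+1%:R^-1) n0 (x : R) => t t0 {}x h.
    rewrite -subr_ge0 (_ : _ - _ = (- x - (2 + t)) * (- x + (2 + t))); last by ring.
    by apply: mulr_ge0; lra.
  move: (n.+1%:R^-1) n0 (x : R) => t t0 {}x h.
  rewrite -subr_ge0 (_ : _ - _ = (x - (2 + t)) * (x + (2 + t))); last by ring.
  by apply: mulr_ge0; lra.
apply/(negligibleP nu (measurableC measurable_disc)).
apply: (@negligibleS _ _ _ _ (\bigcup_n B n)); last first.
  by apply: negligible_bigcup => n; apply/(negligibleP nu (mB n)); exact: B0.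
suff cover (x : R) : ~ D x -> (\bigcup_n B n) x by move=> x; apply: cover.
rewrite /= in_itv /= => /negP.
have key (t : R) : 0 < t -> exists n : nat, n.+1%:R^-1 <= t.
  move=> t0; exists (Num.bound t^-1); have t1 : 0 < t^-1 by rewrite invr_gt0.
  rewrite -[leRHS]invrK lef_pV2 ?posrE ?ltr0n // -natr1.
  by apply: ltW; apply: ltr_wpDr => //; apply: archi_boundP; apply: ltW.
rewrite negb_and -!ltNge => /orP[x2|x2].
  have [|n nx] := key (- 2 - x); first by lra.
  by exists n => //; left; rewrite /= in_itv /=; move: (n.+1%:R^-1) nx => t nx; lra.
have [|n nx] := key (x - 2); first by lra.
by exists n => //; right; rewrite /= in_itv /= andbT; move: (n.+1%:R^-1) nx => t nx; lra.
Qed.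

Lemma integral_monomial k :
  mu.-integrable D (fun x : R => (x ^+ k * (half_circle x / (2 * pi)))%:E) /\
  (\int[mu]_(x in D) (x ^+ k * (half_circle x / (2 * pi)))%:E =
   (moment k / (2 * pi))%:E)%E.
Proof.
have E : (fun x : R => (x ^+ k * (half_circle x / (2 * pi)))%:E) =
    (fun x => ((2 * pi)^-1)%:E * (x ^+ k * half_circle x)%:E)%E.
  by apply/funext=> x; rewrite -EFinM; congr EFin; ring.
rewrite E; have im := integrable_moment (R := R) k; split.
  exact: integrableZl.
rewrite integralZl // [in RHS]mulrC EFinM /moment /Rintegral fineK //.
exact: (integrable_fin_num _ im).
Qed.

Lemma integral_poly (p : {poly R}) :
  nu.-integrable setT (fun x : R => (p.[x])%:E) /\
  (\int[mu]_(x in D) (p.[x] * (half_circle x / (2 * pi)))%:E = \int[nu]_x (p.[x])%:E)%E.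
Proof.
have Enu : (fun x : R => (p.[x])%:E) =
    (fun x => \sum_(i < size p) (p`_i)%:E * (x ^+ i)%:E)%E.
  by apply/funext=> x; rewrite horner_coef -sumEFin.
have Emu : (fun x : R => (p.[x] * (half_circle x / (2 * pi)))%:E) =
    (fun x => \sum_(i < size p) (p`_i)%:E * (x ^+ i * (half_circle x / (2 * pi)))%:E)%E.
  apply/funext=> x; rewrite horner_coef mulr_suml -sumEFin.
  by apply: eq_bigr => i _; rewrite -EFinM; congr EFin; rewrite [RHS]mulrA.
have inu (i : 'I_(size p)) : nu.-integrable setT (fun x : R => (p`_i)%:E * (x ^+ i)%:E)%E.
  by apply: integrableZl => //; apply: integrable_expr.
split; first by rewrite Enu; apply: integrable_sum.
rewrite Enu Emu !integral_sum //; last first.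
  by move=> i; apply: integrableZl => //; case: (integral_monomial i).
apply: eq_bigr => i _; rewrite !integralZl //; last 2 first.
- exact: integrable_expr.
- by case: (integral_monomial i).
by rewrite nu_moments; case: (integral_monomial i) => _ ->.
Qed.

Lemma nu_itv (a : R) : nu `]-oo, a[%classic = semicircle_law `]-oo, a[%classic.
Proof.
rewrite semicircle_law_itv.
(* On [-2, 2] one has |x - a| <= 2 + |a| = K/2, so the affine map [y] takes the segment into [0, 1]
   and [a] to the threshold 1/2. *)
pose K := 2 * (2 + `|a|); have K0 : 0 < K by rewrite mulr_gt0 // ltr_wpDr.
pose y (x : R) := (x - a) / K + 2^-1.
have y01 x : x \in D -> 0 <= y x <= 1.
  rewrite mem_setE in_itv /= => /andP[x1 x2].
  have : `|x - a| / K <= 2^-1.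
    rewrite ler_pdivrMr // /K mulrA mulVf // mul1r.
    by apply: le_trans (ler_normB _ _) _; rewrite lerD2r ler_norml x1.
  by rewrite -[K in _ / K]gtr0_norm // -normf_div ler_norml /y => /andP[? ?]; lra.
have ylt x : (y x < 2^-1) = (x < a).
  by rewrite /y -ltrBrDr subrr pmulr_llt0 ?invr_gt0 // subr_lt0.
pose f n (x : R) : R := step n (y x).
have cvgf x : x \in D -> f n x @[n --> \oo] --> (if x < a then 1 else 0 : R).
  by move=> xD; rewrite -ylt; apply: cvg_step; apply: y01.
(* The functions [f n] as polynomials, to which the equality of moments applies. *)
pose Y : {poly R} := K^-1 *: ('X - a%:P) + (2^-1)%:P.
pose p n : {poly R} := (1 - Y ^+ n) ^+ (n * 2 ^ n).
have pE n x : (p n).[x] = f n x.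
  by rewrite /p /f /step /Y /y !hornerE [_ / K]mulrC.
have f01 n x : x \in D -> 0 <= f n x <= 1.
  by move=> xD; apply: step_bounds; apply: y01.
pose ind (x : R) : R := if x < a then 1 else 0.
have mf n : measurable_fun (D : set (measurableTypeR R)) (fun x : R => (f n x)%:E).
  apply: measurable_funS (_ : measurable_fun setT _) => //.
  by case: (integral_poly (p n)) => /integrableP[+ _] _; under eq_fun do rewrite pE.
have L1 : (\int[nu]_(x in D) (f n x)%:E)%E @[n --> \oo] -->
    (\int[nu]_(x in D) (ind x)%:E)%E.
  apply: (@dominated_cvg _ _ _ _ _ measurable_disc _ _ (cst 1%E)) => //.
  - by move=> x xD; apply: cvg_EFin; [exact: nearW | apply: cvgf; rewrite inE].
  - exact: finite_measure_integrable_cst.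
  - move=> n x xD; have /andP[f0 f1] := f01 n x (mem_set xD).
    by rewrite abse_EFin lee_fin ger0_norm.
have L2 : (\int[mu]_(x in D) (f n x * (half_circle x / (2 * pi)))%:E)%E @[n --> \oo] -->
    (\int[mu]_(x in D) (ind x * (half_circle x / (2 * pi)))%:E)%E.
  apply: (@dominated_cvg _ _ _ _ _ measurable_disc _ _
    (fun x => (half_circle x / (2 * pi))%:E)) => //.
  - move=> n; apply/measurable_EFinP; apply: measurable_funM.
      by apply/measurable_EFinP; apply: mf.
    by apply/measurable_EFinP; case/integrableP: (@integrable_half_circle R).
  - move=> x xD; apply: cvg_EFin; [exact: nearW | apply: cvgM; last exact: cvg_cst].
    by apply: cvgf; rewrite inE.
  - exact: integrable_half_circle.
  - move=> n x xD; rewrite abse_EFin lee_fin; have /andP[f0 f1] := f01 n x (mem_set xD).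
    have h0 : 0 <= half_circle x / (2 * pi).
      by rewrite divr_ge0 ?sqrtr_ge0 // mulr_ge0 // pi_ge0.
    by rewrite ger0_norm; [exact: ler_piMl | exact: mulr_ge0].
(* Moments give integrals over the whole line, while [f n] is bounded by 1 only on [D]; [nu_supp]
   removes the complement. *)
have eqL n : (\int[mu]_(x in D) (f n x * (half_circle x / (2 * pi)))%:E =
    \int[nu]_(x in D) (f n x)%:E)%E.
  have [ip e] := integral_poly (p n).
  under eq_integral do rewrite -pE.
  have mC := measurableC measurable_disc.
  rewrite e; have -> := negligible_integral mC measurableT ip nu_supp.
  by rewrite setTD setCK; apply: eq_integral => x _; rewrite pE.
have <- : (\int[nu]_(x in D) (ind x)%:E =
    \int[mu]_(x in D) (ind x * (half_circle x / (2 * pi)))%:E)%E.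
  rewrite -(cvg_lim (@ereal_hausdorff R) L1) -(cvg_lim (@ereal_hausdorff R) L2).
  by congr (lim (_ @ \oo)); apply/funext=> n; rewrite eqL.
have mA : measurable (`]-oo, a[%classic : set (measurableTypeR R)) by apply: measurable_itv.
transitivity (\int[nu]_(x in D) (\1_(`]-oo, a[%classic : set R) x)%:E)%E; last first.
  by apply: eq_integral => x _; rewrite indicE mem_setE in_itv /= /ind; case: ifP.
rewrite (integral_indic _ measurable_disc mA).
rewrite [LHS](measureDI nu mA measurable_disc).
rewrite (subset_measure0 _ _ _ nu_supp) ?add0e //.
- exact: measurableD mA measurable_disc.
- exact: measurableC measurable_disc.
Qed.

Theorem semicircle_determined A : measurable A -> nu A = semicircle_law A.
Proof. by apply: eq_semicircle_law; exact: nu_itv. Qed.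

End Determinacy.

(** * Odd parameters and conclusion *)

Section OddMoments.
Context d (Om : measurableType d) (R : realType) (P : probability Om R).

(* AM-GM: [2 |t|^(2r+1) <= dl t^2 + t^(4r) / dl] *)
Lemma abse_expectation_odd (X : {RV P >-> R}) (dl : R) (r : nat) : 0 < dl ->
  (`|'E_P[(fun w => X w ^+ r.*2.+1)%R]| <=
   (dl / 2)%:E * 'E_P[(fun w => X w ^+ 2)%R] +
   (2 * dl)^-1%:E * 'E_P[(fun w => X w ^+ (2 * r.*2))%R])%E.
Proof.
move=> dl0; rewrite unlock.
have mX k : measurable_fun setT (fun w => (X w ^+ k)%:E).
  by apply/measurable_EFinP; apply: measurable_funX; apply: measurable_funPT.
have even0 (t : R) k : 0 <= t ^+ (2 * k) by rewrite exprM exprn_ge0 ?sqr_ge0.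
apply: (le_trans (le_abse_integral _ _ _)) => //.
rewrite -!ge0_integralZl //; last 4 first.
- by move=> w _; rewrite lee_fin even0.
- by rewrite lee_fin invr_ge0 mulr_ge0 // ltW.
- by move=> w _; rewrite lee_fin (even0 _ 1).
- by rewrite lee_fin divr_ge0 // ltW.
rewrite -ge0_integralD //; last 4 first.
- by move=> w _; rewrite -EFinM lee_fin mulr_ge0 ?divr_ge0 ?(even0 _ 1) // ltW.
- exact: measurable_funeM.
- by move=> w _; rewrite -EFinM lee_fin mulr_ge0 ?even0 // invr_ge0 mulr_ge0 // ltW.
- exact: measurable_funeM.
apply: ge0_le_integral => //.
- exact: measurableT_comp.
- by apply: emeasurable_funD; apply: measurable_funeM.
move=> w _; rewrite abse_EFin -!EFinM -EFinD lee_fin.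
rewrite mulnC exprM exprSr normrM [`|_ ^+ r.*2|]ger0_norm; last by rewrite -mul2n even0.
move: (X w) => t; move: (t ^+ r.*2) => b.
rewrite -(ler_pM2l (mulr_gt0 (ltr0Sn R 1) dl0)) mulrDr mulVKf ?gt_eqF ?mulr_gt0 //.
rewrite -[t ^+ 2]real_normK ?num_real //; move: `|t| => u.
have := sqr_ge0 (dl * u - b); rewrite (_ : _ * (dl / 2 * _) = dl ^+ 2 * u ^+ 2); last by field.
by rewrite sqrrB exprMn; lra.
Qed.

(** In the limit, |M_(2r+1)| <= dl M_2 / 2 + M_(4r) / (2 dl) for every dl > 0, and M_(4r) = 0.
    Letting dl be small gives the conclusion. *)
Lemma heavy_wigner_odd p (M : nat -> R) (T : tensor_sequence P p) :
  heavy_wigner M T -> (forall r, (1 < r)%N -> M (2 * r)%N = 0) ->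
  forall r, (0 < r)%N -> M r.*2.+1 = 0.
Proof.
move=> hT hM r r0.
(* One increasing index suffices: (0, ..., p-1). *)
pose i n : {ffun 'I_p -> 'I_n.+1} := [ffun s : 'I_p => inord s].
have cM k : (2 <= k)%N -> scaled_moment T k (i n) @[n --> \oo] --> (M k)%:E.
  by move=> k2; apply: (hw_cvg hT (i := @nat_of_ord p)).
have bound dl : 0 < dl -> `|M r.*2.+1| <= dl / 2 * M 2.
  move=> dl0.
  have c1 : (`|scaled_moment T r.*2.+1 (i n)|)%E @[n --> \oo] --> (`|M r.*2.+1|%:E).
    by rewrite -abse_EFin; apply: cvg_abse; apply: cM; lia.
  have c2 : ((dl / 2)%:E * scaled_moment T 2 (i n) +
      (2 * dl)^-1%:E * scaled_moment T (2 * r.*2) (i n))%E @[n --> \oo] --> (dl / 2 * M 2)%:E.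
    have -> : (dl / 2 * M 2)%:E =
        ((dl / 2)%:E * (M 2)%:E + (2 * dl)^-1%:E * (M (2 * r.*2)%N)%:E)%E.
      by rewrite hM ?mule0 ?adde0 ?EFinM //; lia.
    apply: cvgeD => //.
      by apply: cvgeZl => //; apply: cM.
    by apply: cvgeZl => //; apply: cM; lia.
  rewrite -lee_fin; apply: (lee_cvg_to c1 c2); apply: nearW => n.
  rewrite /scaled_moment abseM; set N : R := (n.+1 ^ p.-1)%:R.
  have N0 : 0 <= N by apply: ler0n.
  rewrite gee0_abs ?lee_fin // !(muleCA _ N%:E) -ge0_muleDr.
  - by apply: lee_wpmul2l; rewrite ?lee_fin //; apply: abse_expectation_odd.
  - apply: mule_ge0; first by rewrite lee_fin divr_ge0 // ltW.
    by apply: expectation_ge0 => w; apply: sqr_ge0.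
  - apply: mule_ge0; first by rewrite lee_fin invr_ge0 mulr_ge0 // ltW.
    by apply: expectation_ge0 => w; rewrite exprM exprn_ge0 ?sqr_ge0.
apply/eqP; rewrite -normr_eq0; apply/negPn/negP => M0.
have m0 : 0 < `|M r.*2.+1| by rewrite lt_neqAle eq_sym M0 normr_ge0.
have M20 := normr_ge0 (M 2).
have u1 : 0 < 1 + `|M 2| by rewrite ltr_pwDl.
(* With this dl the bound would read z (1 + |M_2|) <= z M_2 / 2, impossible for z > 0; the 1 avoids
   dividing by zero. *)
set z := `|M r.*2.+1| / (1 + `|M 2|); have z0 : 0 < z by apply: divr_gt0.
have zE : z * (1 + `|M 2|) = `|M r.*2.+1| by rewrite divfK // gt_eqF.
have := bound z z0; have := ler_wpM2l (ltW z0) (ler_norm (M 2)).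
have := mulr_ge0 (ltW z0) M20; move: zE.
move: z z0 `|M r.*2.+1| (M 2) `|M 2| => z z0 m M2 u; lra.
Qed.

End OddMoments.

(** Both sides satisfy the same recursion of step 2, with base cases [moment0] and [moment1]; for
    even [k] the factor [l.*2.+4] of [moment_rec] is twice the [l.+2] of [ballot_rec]. *)
Lemma moment_ballot (R : realType) k :
  moment k / (2 * pi) = (if odd k then 0 else (ballot k 0)%:R) :> R.
Proof.
have pi0 := @pi_gt0 R; have p0 : 2 * pi != 0 :> R by rewrite gt_eqF // mulr_gt0.
rewrite -(odd_double_half k); move: (k./2) => l; rewrite oddD odd_double addbF oddb.
case: (odd k) => /=.
  suff -> : moment (1 + l.*2) = 0 :> R by rewrite mul0r.
  elim: l => [|l IHl]; first exact: moment1.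
  have := moment_rec (R := R) (1 + l.*2); rewrite IHl mulr0 doubleS => /eqP.
  by rewrite mulf_eq0 pnatr_eq0 /= => /eqP.
rewrite add0n; elim: l => [|l IHl]; first by rewrite moment0 divff.
have e1 : (l.+2%:R : R) != 0 by rewrite pnatr_eq0.
apply: (mulfI e1); rewrite -[RHS]natrM mulnC ballot_rec natrM -IHl.
have := moment_rec (R := R) l.*2; rewrite -doubleS.
have -> : l.*2.+4%:R = 2 * l.+2%:R :> R by rewrite -natrM -mul2n; congr _%:R; lia.
move=> h; have {}h : l.+2%:R * moment l.+1.*2 = 2 * l.*2.+1%:R * moment l.*2 :> R by lra.
by rewrite mulrA h natrM mulrA.
Qed.

Theorem lemma1p10 (R : realType) (d : measure_display) (Om : measurableType d)
    (P : probability Om R) (p : nat) (hp : (2 <= p)%N) (M : nat -> R)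
    (T : tensor_sequence P p) (hT : heavy_wigner M T)
    (nu : probability (measurableTypeR R) R)
    (nu_limit : cvg_weakly_in_probability P
       (fun n w => esd (contracted_matrix M T n w)) nu)
    (nu_moments : forall k : nat,
       (\int[nu]_x (x ^+ k)%:E)%E = (eta p (normalised_parameters p M) k)%:E)
    (hM2 : M 2%N = 1) (hM : forall r : nat, (1 < r)%N -> M (2 * r)%N = 0) :
  forall A : set (measurableTypeR R), measurable A -> nu A = semicircle_law A.
Proof.
have hodd := heavy_wigner_odd hT hM.
have a2 : normalised_parameters p M 2 = (p - 2)`!%:R.
  by rewrite /normalised_parameters hM2 divff // powR1 powRr1 // divr1 mulr1.
have a3 r : (2 < r)%N -> normalised_parameters p M r = 0.
  move=> r2; rewrite /normalised_parameters (_ : M r = 0) ?mulr0 ?mul0r //.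
  rewrite -(odd_double_half r); case: (boolP (odd r)) => ro.
    by rewrite add1n hodd //; lia.
  by rewrite add0n -mul2n hM //; lia.
move=> A; apply: semicircle_determined => k; rewrite nu_moments; congr EFin.
case: p hp a2 a3 {T hT nu_limit nu_moments hodd} => [|[|q]] // _.
rewrite subn2 /= => a2 a3; rewrite (eta_ballot a2 a3).
by rewrite moment_ballot.
Qed.
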